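(* Let $n\ge 3$, let $X_1,\ldots,X_n$ be independent standard Gaussian random vectors in $\mathbb{R}^2$, and let $f_{n,2}(|x|)=\mathbb{P}[x\notin\operatorname{Conv}(X_1,\ldots,X_n)]$, $x\in\mathbb{R}^2$ (which depends only on the Euclidean norm $|x|$). Let $\xi,\xi_1,\ldots,\xi_n$ be standard normal random variables and let $W$ be a random variable with the arcsine density $\frac{1}{\pi} (1-y^2)^{-1/2}$ on $[-1,1]$, all variables being independent. Define $M_{k}= \max\{\xi_1,\ldots,\xi_{k}\}$. Then, for all $u\geq 0$, $$ f_{n,2}(\sqrt{2u}) = \mathbb{P}[ M_{n}^2 + \xi^2 \leq 2u] + \frac {\mathrm{d}}{\mathrm{d} u}\mathbb{P}[ M_{n}^2 + \xi^2 \leq 2u] = \mathbb{P}[ M_{n}^2 + \xi^2 \leq 2u] + n\,\mathrm{e}^{-u}\, \mathbb{P}[M_{n-1} \leq \sqrt{2u}\, W]. $$ That is, $f_{n,2}(\sqrt{2u})$ is the sum of the distribution function and the density of the random variable $\frac 12 (M_n^2+\xi^2)$ at $u$.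
   Context: $\operatorname{Conv}$ denotes the convex hull. At $u=0$ the derivative with respect to $u$ is understood as the right derivative. *)

(* Defs.v *)
From HB Require Import structures.
From mathcomp Require Import all_boot all_order all_algebra.
From mathcomp Require Import all_classical all_reals all_analysis.

Set Implicit Arguments.
Unset Strict Implicit.
Unset Printing Implicit Defensive.

Import Order.TTheory GRing.Theory Num.Def Num.Theory.
Import numFieldTopology.Exports numFieldNormedType.Exports.

Local Open Scope classical_set_scope.
Local Open Scope ring_scope.

Definition mutually_independent d d' (T : measurableType d)
    (T' : measurableType d') (R : realType) (P : probability T R)
    (I : finType) (X : I -> {RV P >-> T'}) : Prop :=
  forall (J : {set I}) (A : I -> set T'),
    (forall i, i \in J -> measurable (A i)) ->
    P (\bigcap_(i in [set i | i \in J]) (X i @^-1` A i)) =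
    (\prod_(i in J) P (X i @^-1` A i))%E.

(* Laws are compared on measurable sets only: a measure of the library is a
   function on all sets, with irrelevant values on the nonmeasurable ones. *)
Definition standard_normal d (T : measurableType d) (R : realType)
    (P : probability T R) (X : {RV P >-> R}) : Prop :=
  forall A : set R, measurable A -> distribution P X A = normal_prob 0 1 A.

Definition standard_gaussian2 d (T : measurableType d) (R : realType)
    (P : probability T R) (X : {RV P >-> (R * R)%type}) : Prop :=
  forall A : set (R * R)%type, measurable A ->
    distribution P X A = (normal_prob (0 : R) 1 \x normal_prob (0 : R) 1)%E A.

Definition has_density d (T : measurableType d) (R : realType)
    (P : probability T R) (X : T -> R) (g : R -> R) : Prop :=
  [/\ measurable_fun [set: R] g,
      forall y, 0 <= g y
    & forall A : set R, measurable A ->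
        P (X @^-1` A) = (\int[lebesgue_measure]_(y in A) (g y)%:E)%E].

(* At the endpoints -1 and 1 the value is 0, since 0^-1 = 0. *)
Definition arcsine_pdf (R : realType) (y : R) : R :=
  if -1 <= y <= 1 then pi^-1 * (Num.sqrt (1 - y ^+ 2))^-1 else 0.

(* The norm that the library puts on [R * R] is the sup norm. *)
Definition euclidean_norm (R : realType) (x : R * R) : R :=
  Num.sqrt (x.1 ^+ 2 + x.2 ^+ 2).

Definition convex_hull (R : realType) (E : lmodType R) (A : set E) : set E :=
  smallest (@convex_set R E) A.

(* [R^o * R^o] is [R * R] with its structure of module over [R]. *)
Definition prob_notin_hull d (T : measurableType d) (R : realType)
    (P : probability T R) (n : nat) (X : 'I_n -> {RV P >-> (R * R)%type})
    (x : R * R) : R :=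
  fine (P [set t | ~ convex_hull [set (X i t : R^o * R^o) | i in [set: 'I_n]]
                       (x : R^o * R^o)]).

(* [prob_notin_hull X] is radial for standard Gaussian vectors; its profile
   is read off along the first coordinate axis. *)
Definition f_n2 d (T : measurableType d) (R : realType) (P : probability T R)
    (n : nat) (X : 'I_n -> {RV P >-> (R * R)%type}) (r : R) : R :=
  prob_notin_hull X (r, 0).

(* The maximum of [xi 0, ..., xi k.-1], meaningful for [0 < k]. *)
Definition running_max d (T : measurableType d) (R : realType)
    (P : probability T R) (xi : nat -> {RV P >-> R}) (k : nat) (t : T) : R :=
  \big[Num.max/xi 0%N t]_(i < k) xi i t.

(* The family xi0, W, xi 0, ..., xi n.-1. *)
Definition joint_family d (T : measurableType d) (R : realType)
    (P : probability T R) (n : nat) (xi0 W : {RV P >-> R})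
    (xi : nat -> {RV P >-> R}) (j : option (option 'I_n)) : {RV P >-> R} :=
  match j with
  | None => xi0
  | Some None => W
  | Some (Some i) => xi i
  end.

(* Differentiation on [0, +oo[, one-sided at 0. *)
Definition derivable_nneg (R : realType) (F : R -> R) (u : R) : Prop :=
  if u == 0 then cvg ((h^-1 * (F h - F 0)) @[h --> (0 : R)^'+])
  else derivable F u 1.

Definition derive_nneg (R : realType) (F : R -> R) (u : R) : R :=
  if u == 0 then lim ((h^-1 * (F h - F 0)) @[h --> (0 : R)^'+])
  else (F^`())%classic u.

(* Main.v *)
Require Import Defs.
From HB Require Import structures.
From mathcomp Require Import all_boot all_order all_algebra.
From mathcomp Require Import all_classical all_reals all_analysis.
From mathcomp Require Import measurable_realfun.
From mathcomp Require Import ring lra.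

Set Implicit Arguments.
Unset Strict Implicit.
Unset Printing Implicit Defensive.

Import Order.TTheory GRing.Theory Num.Def Num.Theory.
Import numFieldTopology.Exports numFieldNormedType.Exports.

Local Open Scope classical_set_scope.
Local Open Scope ring_scope.

(** Let x lie at distance r from the origin, and put u = r^2 / 2.

    If x is outside the hull, the sample points are seen from x within an angle
    smaller than pi.  Almost surely exactly one of them then has all the others
    strictly to its left, as seen from x, and each of the n points plays this
    part with the same probability.  Given that this point is y, the others are
    independent, and each is to the left of the line from x to y with
    probability Phi (s), where s is the signed distance from the origin to that
    line.  Hence ([probability_notin_hull])
      P [x not in the hull] = n E [Phi (s (X_1))^(n-1)].

    This expectation is computed in polar coordinates centred at x.  For a
    uniform angle the sine w of the direction follows the arcsine law ([polar]).
    With c = sqrt (1 - w^2), one has s = r w, and the integral of the Gaussian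
    density over the two opposite directions (c, w) and (- c, w) reduces to
      int_0^oo p (phi (p + r c) + phi (p - r c)) dp
        = 2 phi (r c) + r c (Phi (r c) - Phi (- r c))
    ([gaussian_first_moment]).  Since 2 pi phi (r c) phi (r w) = e^(-u), the
    first term contributes n e^(-u) E [Phi (r W)^(n-1)], that is
    n e^(-u) P [M_(n-1) <= r W].  In the second term the arcsine density cancels
    c; after the substitution s = r w it is the integral of the density
    n Phi (s)^(n-1) phi (s) of M_n against the Gaussian mass of the chord of the
    disk of radius r at height s, that is P [M_n^2 + xi^2 <= r^2]
    ([hull_integral], [disk_mass_chord]).

    Finally the same disk probability, computed in polar coordinates centred at
    the origin, is int_0^u n e^(-v) E [Phi (sqrt (2 v) W)^(n-1)] dv
    ([disk_mass_radial]).  The integrand is continuous, so it is both the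
    derivative of the distribution function and the density of
    (M_n^2 + xi^2) / 2. *)

(** * Convex hulls in the plane *)

Section Geometry.
Context {R : realType}.
Local Notation V := (R^o * R^o)%type.
Implicit Types x a b c z : V.

(** Twice the signed area of the triangle x a b: positive when b is to the
    left of the line from x to a. *)
Definition orient (x a b : V) : R :=
  (a.1 - x.1) * (b.2 - x.2) - (a.2 - x.2) * (b.1 - x.1).

(** Seen from x, the point a precedes b counterclockwise within an angle in
    [0, pi[.  Points on a common ray precede each other, so that the
    criterion [notin_convex_hullP] holds for every sample and describes a
    measurable event. *)
Definition cw_of (x a b : V) : Prop :=
  0 < orient x a b \/
  (orient x a b = 0 /\
   0 < (a.1 - x.1) * (b.1 - x.1) + (a.2 - x.2) * (b.2 - x.2)).

Lemma conv_pairP (t : {i01 R}) (x y : convex_lmodType V) :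
  exists s : R, [/\ 0 <= s, s <= 1 & conv t x y =
    (s * x.1 + (1 - s) * y.1, s * x.2 + (1 - s) * y.2)].
Proof. by exists t%:num; split; rewrite //. Qed.

Lemma convex_set_pair (C : set (convex_lmodType V)) (s : R) a b :
  convex_set C -> C a -> C b -> 0 <= s -> s <= 1 ->
  C (s * a.1 + (1 - s) * b.1, s * a.2 + (1 - s) * b.2).
Proof.
move=> cC Ca Cb s0 s1.
have s01 : Itv.spec (@Itv.num_sem R) (Itv.Real `[0%Z, 1%Z]) s.
  rewrite /= /Itv.num_sem /= in_itv /= s0 s1 !andbT; exact: num_real.
have := cC a b (Itv.mk s01); rewrite !inE; exact.
Qed.

(** The set is an open half-plane bounded by the line from x to a, with the
    open ray from x through a added. *)
Lemma convex_cw_of x a : convex_set [set z | cw_of x a z].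
Proof.
move=> z z' t; rewrite !inE /=; case: (conv_pairP t z z') => s [s0 s1 ->].
case: z z' => [x1 x2] [y1 y2]; rewrite /cw_of /orient /=.
have -> : (a.1 - x.1) * (s * x2 + (1 - s) * y2 - x.2) -
          (a.2 - x.2) * (s * x1 + (1 - s) * y1 - x.1) =
  s * ((a.1 - x.1) * (x2 - x.2) - (a.2 - x.2) * (x1 - x.1)) +
  (1 - s) * ((a.1 - x.1) * (y2 - x.2) - (a.2 - x.2) * (y1 - x.1)) by ring.
have -> : (a.1 - x.1) * (s * x1 + (1 - s) * y1 - x.1) +
          (a.2 - x.2) * (s * x2 + (1 - s) * y2 - x.2) =
  s * ((a.1 - x.1) * (x1 - x.1) + (a.2 - x.2) * (x2 - x.2)) +
  (1 - s) * ((a.1 - x.1) * (y1 - x.1) + (a.2 - x.2) * (y2 - x.2)) by ring.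
move: (_ - _ * (x1 - _)) (_ - _ * (y1 - _)) => X Y.
move: (_ + _ * (x2 - _)) (_ + _ * (y2 - _)) => DX DY.
have [->|sn0] := eqVneq s 0; first by rewrite !mul0r !add0r subr0 !mul1r.
have [->|sn1] := eqVneq s 1; first by rewrite !mul1r subrr !mul0r !addr0.
have sp : 0 < s by rewrite lt0r sn0.
have sp1 : 0 < 1 - s by rewrite subr_gt0 lt_neqAle sn1.
case=> [X0|[-> DX0]]; case=> [Y0|[-> DY0]].
- by left; rewrite addr_gt0// mulr_gt0.
- by left; rewrite mulr0 addr0 mulr_gt0.
- by left; rewrite mulr0 add0r mulr_gt0.
- by right; split; [rewrite !mulr0 addr0 | rewrite addr_gt0// mulr_gt0].
Qed.

Lemma cw_of_irr x a : ~ cw_of x a x.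
Proof.
rewrite /cw_of /orient !subrr !mulr0 subrr addr0.
by case=> [|[_]]; rewrite ltxx.
Qed.

Lemma weighted_meanE (A D p q : R) : A + D != 0 ->
  (D / (A + D) * p + (1 - D / (A + D)) * q) * (A + D) = D * p + A * q.
Proof. by move=> AD; field. Qed.

(** When x is aligned with two points of a convex set that misses it, the two
    points are on the same side of x. *)
Lemma segment_apex (C : set (convex_lmodType V)) x a b :
  convex_set C -> C a -> C b -> ~ C x -> orient x a b = 0 ->
  0 < (a.1 - x.1) * (b.1 - x.1) + (a.2 - x.2) * (b.2 - x.2).
Proof.
case: x a b => [x1 x2] [a1 a2] [b1 b2] cC Ca Cb nCx; rewrite /orient /= => o0.
rewrite ltNge; apply/negP => dle0; apply: nCx.
set u1 : R := a1 - x1 in o0 dle0; set u2 : R := a2 - x2 in o0 dle0.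
set v1 : R := b1 - x1 in o0 dle0; set v2 : R := b2 - x2 in o0 dle0.
(* With u = a - x and v = b - x parallel, |u|^2 v = (u . v) u: hence x is the
   mean of a and b with weights - (u . v) and |u|^2. *)
pose A : R := u1 ^+ 2 + u2 ^+ 2; pose D : R := - (u1 * v1 + u2 * v2).
have D0 : 0 <= D by rewrite oppr_ge0.
have A0 : 0 <= A by rewrite addr_ge0// sqr_ge0.
have [Az|An] := eqVneq A 0.
  have /andP[/eqP u10 /eqP u20] : (u1 == 0) && (u2 == 0).
    by rewrite -(sqrf_eq0 u1) -(sqrf_eq0 u2) -paddr_eq0 ?sqr_ge0//; apply/eqP.
  suff -> : (x1, x2) = (a1, a2) by [].
  by congr pair; apply/esym/eqP; rewrite -subr_eq0; apply/eqP.
have AD : 0 < A + D by rewrite ltr_pwDl// lt0r An.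
have -> : (x1, x2) = (D / (A + D) * (a1, a2).1 + (1 - D / (A + D)) * (b1, b2).1,
                     D / (A + D) * (a1, a2).2 + (1 - D / (A + D)) * (b1, b2).2).
  have E1 : D * u1 + A * v1 = 0.
    rewrite /D /A; transitivity (- u2 * (u1 * v2 - u2 * v1)); first by ring.
    by rewrite o0 mulr0.
  have E2 : D * u2 + A * v2 = 0.
    rewrite /D /A; transitivity (u1 * (u1 * v2 - u2 * v1)); first by ring.
    by rewrite o0 mulr0.
  have F1 : (x1 : R) * (A + D) = D * a1 + A * b1.
    by apply/eqP; rewrite -subr_eq0 -oppr_eq0 -E1 /u1 /v1; apply/eqP; ring.
  have F2 : (x2 : R) * (A + D) = D * a2 + A * b2.
    by apply/eqP; rewrite -subr_eq0 -oppr_eq0 -E2 /u2 /v2; apply/eqP; ring.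
  have ADn : A + D != 0 by rewrite gt_eqF.
  by congr pair; apply: (mulIf ADn) => /=; rewrite ?F1 ?F2 weighted_meanE.
apply: (@convex_set_pair C (D / (A + D)) (a1, a2) (b1, b2)) => //.
  by rewrite divr_ge0// ltW.
by rewrite ler_pdivrMr// mul1r lerDr.
Qed.

Lemma barycentreE (f g h p q o : R) : g + h != 0 -> f + g + h != 0 ->
  (g + h) / (f + g + h) * (g / (g + h) * p + (1 - g / (g + h)) * q) +
  (1 - (g + h) / (f + g + h)) * o = (g * p + h * q + f * o) / (f + g + h).
Proof. by move=> gh fgh; field; rewrite fgh gh. Qed.

(** The barycentric coordinates of x in the triangle a b c are proportional to
    the three areas. *)
Lemma triangle_apex (C : set (convex_lmodType V)) x a b c :
  convex_set C -> C a -> C b -> C c ->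
  0 < orient x a b -> 0 < orient x b c -> 0 < orient x c a -> C x.
Proof.
move=> cC Ca Cb Cc ab0 bc0 ca0.
pose S := orient x a b + orient x b c + orient x c a.
have S0 : 0 < S by rewrite /S; apply: addr_gt0 => //; apply: addr_gt0.
pose T := orient x b c + orient x c a.
have T0 : 0 < T by apply: addr_gt0.
pose s := orient x b c / T; pose r := T / S.
have Cm : C (s * a.1 + (1 - s) * b.1, s * a.2 + (1 - s) * b.2).
  apply: (@convex_set_pair C s a b) => //; first by rewrite divr_ge0// ltW.
  by rewrite ler_pdivrMr// mul1r lerDl ltW.
pose m : V := (s * a.1 + (1 - s) * b.1, s * a.2 + (1 - s) * b.2).
have -> : x = (r * m.1 + (1 - r) * c.1, r * m.2 + (1 - r) * c.2).
  have E := barycentreE _ _ _ (lt0r_neq0 T0) (lt0r_neq0 S0).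
  rewrite /= !E [LHS]surjective_pairing; congr pair; apply: (mulIf (lt0r_neq0 S0));
    rewrite divfK ?lt0r_neq0// /S /orient; ring.
apply: (@convex_set_pair C r m c) => //; first by rewrite divr_ge0// ltW.
by rewrite ler_pdivrMr// mul1r /S /T -(addrA (orient x a b)) lerDr ltW.
Qed.

Lemma orientC x a b : orient x b a = - orient x a b.
Proof. by rewrite /orient; ring. Qed.

(** By induction on the list: a new point c either comes after the current
    first point a, or becomes the first one itself; otherwise some point b, with
    a and c, surrounds x. *)
Lemma exists_clockwise_most (C : set (convex_lmodType V)) x (s : seq V) :
  convex_set C -> ~ C x -> (forall a, a \in s -> C a) -> s != [::] ->
  exists2 a, a \in s & forall b, b \in s -> cw_of x a b.
Proof.
move=> cC nCx; elim: s => // c s IH Cs _.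
have Cc : C c by apply: Cs; rewrite mem_head.
have Cs' a : a \in s -> C a by move=> sa; apply: Cs; rewrite in_cons sa orbT.
have cc : cw_of x c c.
  have o0 : orient x c c = 0 by rewrite /orient; ring.
  by right; split => //; exact: (segment_apex cC).
have [s0|sn0] := eqVneq s [::].
  by exists c; rewrite ?mem_head// s0 => b; rewrite inE => /eqP ->.
have [a sa ha] := IH Cs' sn0; have Ca := Cs' a sa.
have ok : cw_of x a c -> exists2 a, a \in c :: s &
    forall b, b \in c :: s -> cw_of x a b.
  move=> ac; exists a; first by rewrite in_cons sa orbT.
  by move=> b; rewrite in_cons => /predU1P[->//|]; exact: ha.
have [ac|ac|ac] := ltgtP (orient x a c) 0; last 2 first.
- by apply: ok; left.
- by apply: ok; right; split => //; exact: (segment_apex cC).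
have [cs|] := pselect (forall b, b \in s -> cw_of x c b).
  exists c; first by rewrite mem_head.
  by move=> b; rewrite in_cons => /predU1P[->//|]; exact: cs.
move=> /existsNP[b /not_implyP[sb ncb]]; exfalso.
have Cb := Cs' b sb.
have cb : orient x c b < 0.
  have [//|cb|cb] := ltgtP (orient x c b) 0; exfalso; apply: ncb; first by left.
  by right; split => //; exact: (segment_apex cC).
have ca : 0 < orient x c a by rewrite orientC oppr_gt0.
have bc : 0 < orient x b c by rewrite orientC oppr_gt0.
have [ab|[ab dab]] := ha b sb; first exact: nCx (triangle_apex cC Ca Cb Cc ab bc ca).
(* a and b are on the same ray from x, so c has them on the same side. *)
have : orient x c b * ((a.1 - x.1) ^+ 2 + (a.2 - x.2) ^+ 2) =
    ((a.1 - x.1) * (b.1 - x.1) + (a.2 - x.2) * (b.2 - x.2)) * orient x c a +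
    orient x a b * ((a.1 - x.1) * (c.1 - x.1) + (a.2 - x.2) * (c.2 - x.2)).
  by rewrite /orient; ring.
rewrite ab mul0r addr0 => E.
have : 0 < orient x c b * ((a.1 - x.1) ^+ 2 + (a.2 - x.2) ^+ 2).
  by rewrite E mulr_gt0.
by rewrite ltNge nmulr_rle0// addr_ge0// sqr_ge0.
Qed.

(** A first point as seen from x certifies that x is outside the hull because
    the set of [convex_cw_of] is convex, contains the sample and misses x. *)
Lemma notin_convex_hullP (I : finType) (Y : I -> V) x : (0 < #|I|)%N ->
  ~ convex_hull [set Y i | i in [set: I]] x <->
  exists i, forall j, cw_of x (Y i) (Y j).
Proof.
move=> I0; split.
  move=> nH; have cH : convex_set (convex_hull [set Y i | i in [set: I]]).
    move=> a b t; rewrite !inE => Ha Hb A [cA YA].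
    have := cA a b t; rewrite !inE; apply; [exact: Ha|exact: Hb].
  have := @exists_clockwise_most _ x [seq Y i | i <- enum I] cH nH.
  case.
  - move=> a /mapP[i _ ->] A [_ YA].
    by apply: YA; exists i.
  - by rewrite -size_eq0 size_map -cardE -lt0n.
  - move=> /= a /mapP[i _ ->] hi; exists i => j; apply: hi.
    by apply: map_f; rewrite mem_enum.
case=> i hi /(_ [set z | cw_of x (Y i) z]) /=.
have := @cw_of_irr x (Y i); apply: contra_not => /=; apply; split.
  exact: convex_cw_of.
by move=> _ [j _ <-]; exact: hi.
Qed.

End Geometry.

(** * Conditioning on one variable of an independent family *)

Section Independence.
Context d d' (T : measurableType d) (T' : measurableType d') (R : realType)
  (P : probability T R) (I : finType) (X : I -> {RV P >-> T'}).
Hypothesis X_indep : mutually_independent X.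
Variables (i0 : I) (J : {set I}).
Hypothesis i0J : i0 \notin J.

(** These events form a pi-system generating the sigma-algebra of the X j,
    j in J, and mutual independence gives their probability as a product. *)
Definition joint_rectangles : set (set T) :=
  [set E | exists2 B : I -> set T', (forall j, measurable (B j)) &
    E = \bigcap_(j in [set j | j \in J]) (X j @^-1` B j)].

(** The sample space with the sigma-algebra generated by the X j, j in J.  It
    stands for the joint value of these variables, so that no product of
    J-indexed copies of T' is needed. *)
Definition sigma_of : Type := g_sigma_algebraType joint_rectangles.
HB.instance Definition _ := Measurable.on sigma_of.

Let mXpre j (B : set T') : measurable B -> measurable (X j @^-1` B).
Proof. by move=> mB; rewrite -[X in measurable X]setTI; exact: measurable_funP. Qed.

Lemma joint_rectangles_measurable E : joint_rectangles E -> d.-measurable E.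
Proof.
case=> B mB ->; apply: fin_bigcap_measurable => [|j _]; last exact: mXpre.
exact: finite_finset.
Qed.

Lemma measurable_sigma_of : measurable_fun [set: T] (id : T -> sigma_of).
Proof.
move=> _ E mE; rewrite setTI preimage_id.
apply: smallest_sub mE; first exact: (@sigma_algebra_measurable _ T).
exact: joint_rectangles_measurable.
Qed.

Lemma measurable_sigma_of_RV j : j \in J ->
  measurable_fun [set: sigma_of] (X j : sigma_of -> T').
Proof.
move=> jJ _ B mB; rewrite setTI; apply: sub_sigma_algebra.
exists (fun k => if k == j then B else setT); first by move=> k; case: ifP.
apply/seteqP; split => t /=.
  by move=> Bt k _ /=; case: eqP => [->|].
by move=> /(_ j jJ) /=; rewrite eqxx.
Qed.

Lemma joint_rectangles_setI : setI_closed joint_rectangles.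
Proof.
move=> _ _ [A mA ->] [B mB ->]; exists (fun j => A j `&` B j).
  by move=> j; exact: measurableI.
by rewrite -bigcapI.
Qed.

Local Notation idS := (id : T -> sigma_of).

(** Both sides are finite measures in B that agree on the pi-system
    [joint_rectangles]. *)
Lemma indep_sigma_of (A : set T') (B : set sigma_of) :
  measurable A -> measurable B ->
  P (X i0 @^-1` A `&` B) = (P (X i0 @^-1` A) * P B)%E.
Proof.
move=> mA mB.
have mXA := mXpre i0 mA; have mid := measurable_sigma_of.
pose c : {nonneg R} := NngNum (fine_ge0 (measure_ge0 P (X i0 @^-1` A))).
have cE : c%:num%:E = P (X i0 @^-1` A) by rewrite /= fineK// fin_num_measure.
(* The two measures of B: the restriction of P to the event on X i0, and the
   multiple of P by the probability of this event. *)
have ctE : mscale c (pushforward P idS) B = (P (X i0 @^-1` A) * P B)%E.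
  by rewrite /mscale /= cE.
rewrite -ctE setIC -[LHS]/(pushforward (mrestr P mXA) idS B).
apply: (@measure_unique _ R sigma_of joint_rectangles (fun=> setT)) => //.
- exact: joint_rectangles_setI.
- by move=> _; exists (fun=> setT) => //; apply/seteqP; split.
- by rewrite bigcup_const.
- move=> _ [C mC ->] /=; rewrite /mscale /= /mrestr /pushforward /= fineK ?fin_num_measure//.
  rewrite preimage_id.
  pose C' j := if j == i0 then A else C j.
  have -> : \bigcap_(j in [set j | j \in J]) X j @^-1` C j `&` X i0 @^-1` A =
      \bigcap_(j in [set j | j \in i0 |: J]) X j @^-1` C' j.
    apply/seteqP; split => t /=.
      move=> [Ct At] j /=; rewrite in_setU1 /C' /preimage/=.
      by case: eqP => [->//|_ /=]; exact: Ct.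
    move=> C't; split.
      move=> j /= jJ; have := C't j; rewrite /= in_setU1 jJ orbT /C' => /(_ isT).
      by case: eqP => // ji; move: i0J; rewrite -ji jJ.
    by have := C't i0; rewrite /= in_setU1 eqxx /C' eqxx; exact.
  rewrite (X_indep (J := i0 |: J)); last by move=> j _; rewrite /C'; case: eqP.
  rewrite (X_indep (J := J))// big_setU1//= {1}/C' eqxx; congr (_ * _)%E.
  apply: eq_bigr => j jJ; rewrite /C'; case: eqP => // ji.
  by move: i0J; rewrite -ji jJ.
- move=> _ /=; rewrite /pushforward/= /mrestr preimage_setT setTI.
  by rewrite (le_lt_trans (probability_le1 _ _))// ltry.
Qed.

Lemma measurable_section (D : set (T' * sigma_of)) : measurable D ->
  measurable_fun setT (fun y => P [set t | D (y, t)]).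
Proof.
move=> mD; have mid := isMeasurableFun.Build _ _ _ _ _ measurable_sigma_of.
pose idR : {RV P >-> sigma_of} := HB.pack idS mid.
rewrite (_ : (fun y => _) = distribution P idR \o xsection D).
  exact: measurable_fun_xsection.
apply/funext => y /=; rewrite /distribution /pushforward /=.
by congr (P _); apply/seteqP; split => t /=; rewrite /xsection /= inE.
Qed.

(** X i0 is independent of the identity map to [sigma_of], so the law of the
    pair is a product measure and its mass on D is an iterated integral. *)
Lemma indep_disintegration (D : set (T' * sigma_of)) : measurable D ->
  P [set t | D (X i0 t, t)] =
  (\int[distribution P (X i0)]_y P [set t | D (y, t)])%E.
Proof.
move=> mD.
pose f t := (X i0 t, idS t).
have mf : measurable_fun setT f.
  by apply: measurable_fun_pair => //; exact: measurable_sigma_of.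
have mid := isMeasurableFun.Build _ _ _ _ _ measurable_sigma_of.
pose idR : {RV P >-> sigma_of} := HB.pack idS mid.
rewrite -[LHS]/(pushforward P f D).
rewrite -(@product_measure_unique _ _ _ _ R (distribution P (X i0))
  (distribution P idR))//.
  apply: eq_integral => y _ /=; rewrite /distribution /pushforward /=.
  by congr (P _); apply/seteqP; split => t /=; rewrite /xsection /= inE.
by move=> A B mA mB; exact: indep_sigma_of.
Qed.

End Independence.

(** * Measures with a density and affine substitutions on the line *)

Section Densities.
Context {R : realType}.
Local Notation mu := (@lebesgue_measure R).
Implicit Types (f : R -> \bar R) (g : R -> R).

Local Open Scope ereal_scope.

(** The proofs are arguments so that the measure structure can be inferred. *)
Definition density_measure g (mg : measurable_fun setT g)
    (g0 : forall x, (0 <= g x)%R) (A : set (measurableTypeR R)) : \bar R :=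
  \int[mu]_(x in A) (g x)%:E.

Section instance.
Variables (g : R -> R) (mg : measurable_fun setT g)
  (g0 : forall x, (0 <= g x)%R).
Local Notation nu := (density_measure mg g0).

Let nu_set0 : nu set0 = 0.
Proof. by rewrite /density_measure integral_set0. Qed.

Let nu_ge0 A : 0 <= nu A.
Proof. by apply: integral_ge0 => x _; rewrite lee_fin. Qed.

Let nu_sigma_additive : semi_sigma_additive nu.
Proof.
move=> /= A mA tA mUA; rewrite /density_measure ge0_integral_bigcup//=.
- apply: is_cvg_ereal_nneg_natsum_cond => k _ _.
  by apply: integral_ge0 => x _; rewrite lee_fin.
- exact/measurable_EFinP/measurable_funTS.
- by move=> x _; rewrite lee_fin.
Qed.

HB.instance Definition _ := isMeasure.Build _ _ _
  nu nu_set0 nu_ge0 nu_sigma_additive.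

End instance.

Lemma measure_unique_ocitv (m1 m2 : {measure set (measurableTypeR R) -> \bar R}) :
  (forall a b : R, (a < b)%R -> m1 `]a, b]%classic < +oo) ->
  (forall a b : R, (a < b)%R -> m1 `]a, b]%classic = m2 `]a, b]%classic) ->
  forall A, measurable A -> m1 A = m2 A.
Proof.
move=> m1oo m12.
apply: (@measure_unique _ R (measurableTypeR R) (@ocitv R)
  (fun k => `](- k%:R)%R, k%:R]%classic)) => //.
- exact: ocitvI.
- by move=> i; exists ((- i%:R)%R, i%:R).
- rewrite -subTset => x _; exists (truncn `|x|).+1 => //=.
  have := truncnS_gt `|x|%R; set k := _.+1%:R => xk.
  rewrite in_itv/= ltrNl (le_lt_trans _ xk) ?(le_trans _ (ltW xk)) ?ler_norm//.
  by rewrite -normrN ler_norm.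
- move=> _ [[a b] _ <-] /=; have [ab|ba] := ltP a b; first exact: m12.
  by rewrite set_itv_ge ?measure0// bnd_simp -leNgt.
- case=> [|k]; first by rewrite oppr0 set_itv_ge ?measure0// bnd_simp ltxx.
  by apply: m1oo; rewrite (@lt_trans _ _ 0%R)// ?oppr_lt0.
Qed.

Lemma density_unique (m : {measure set (measurableTypeR R) -> \bar R}) g :
  measurable_fun setT g -> (forall x, (0 <= g x)%R) ->
  (forall a b : R, (a < b)%R -> m `]a, b]%classic < +oo) ->
  (forall a b : R, (a < b)%R -> m `]a, b]%classic = \int[mu]_(x in `]a, b]) (g x)%:E) ->
  forall A, measurable A -> m A = \int[mu]_(x in A) (g x)%:E.
Proof.
move=> mg g0 moo mE A mA.
exact: (@measure_unique_ocitv m (density_measure mg g0)).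
Qed.

Lemma density_unique_ray (m : {measure set (measurableTypeR R) -> \bar R}) (g : R -> R) :
  measurable_fun setT g -> (forall x, (0 <= g x)%R) ->
  (forall a : R, m `]-oo, a]%classic < +oo) ->
  (forall a : R, m `]-oo, a]%classic = \int[mu]_(x in `]-oo, a]) (g x)%:E) ->
  forall A, measurable A -> m A = \int[mu]_(x in A) (g x)%:E.
Proof.
move=> mg g0 moo mE A mA.
have E (m' : {measure set (measurableTypeR R) -> \bar R}) (a b : R) : (a < b)%R ->
    m' `]-oo, b]%classic < +oo ->
    m' `]a, b]%classic = m' `]-oo, b]%classic - m' `]-oo, a]%classic.
  move=> ab m'oo; rewrite (_ : `]a, b]%classic = `]-oo, b]%classic `\` `]-oo, a]%classic).
    rewrite measureD// setIidr//; apply: subset_itvl; rewrite bnd_simp; exact: ltW.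
  apply/seteqP; split => t /=; rewrite !in_itv/=.
    by move=> /andP[at_ ->]; split => //; apply/negP; rewrite -ltNge.
  by move=> [-> /negP]; rewrite -ltNge => ->.
apply: (@measure_unique_ocitv m (density_measure mg g0)) => // a b ab.
  by rewrite (le_lt_trans _ (moo b))// le_measure ?inE//; exact: subset_itvr.
rewrite E// [RHS]E//=.
- by rewrite -[density_measure mg g0 `]-oo, b]%classic]/(\int[mu]_(x in `]-oo, b]) (g x)%:E)
    -[density_measure mg g0 `]-oo, a]%classic]/(\int[mu]_(x in `]-oo, a]) (g x)%:E) -!mE.
- by rewrite -[density_measure mg g0 `]-oo, b]%classic]/(\int[mu]_(x in `]-oo, b]) (g x)%:E) -mE.
Qed.

(** The image of Lebesgue measure by x |-> a x + b, multiplied by a, gives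
    ]s, t] the mass t - s. *)
Lemma integral_affine_gt0 (a b : R) f : (0 < a)%R ->
  measurable_fun setT f -> (forall x, 0 <= f x) ->
  \int[mu]_x f x = a%:E * \int[mu]_x f (a * x + b)%R.
Proof.
move=> a0 mf f0.
pose h : measurableTypeR R -> measurableTypeR R := fun x => (a * x + b)%R.
have mh : measurable_fun setT h.
  by apply: measurable_funD => //; exact: measurable_funM.
pose a' : {nonneg R} := NngNum (ltW a0).
have muE A : measurable A -> mu A = mscale a' (pushforward mu h) A.
  apply: lebesgue_measure_unique => /= _ [[s t] _ <-] /=.
  rewrite /mscale /= /pushforward.
  have -> : h @^-1` `]s, t]%classic = `]((s - b) / a)%R, ((t - b) / a)%R]%classic.
    apply/seteqP; split => x /=; rewrite !in_itv/= /h ltr_pdivrMr// ler_pdivlMr//;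
    by rewrite ltrBlDr lerBrDr (mulrC x).
  rewrite !lebesgue_measure_itv/= !lte_fin ltr_pM2r ?invr_gt0// ltrD2r.
  case: ifP => _; last by rewrite mule0.
  by rewrite -EFinB -!EFinM; congr EFin; field; rewrite gt_eqF.
rewrite (eq_measure_integral (mscale a' (pushforward mu h))); last first.
  by move=> A mA _; exact: muE.
rewrite ge0_integral_mscale//= ge0_integral_pushforward//.
Qed.

Lemma integral_oppr f : measurable_fun setT f -> (forall x, 0 <= f x) ->
  \int[mu]_x f x = \int[mu]_x f (- x)%R.
Proof.
move=> mf f0.
rewrite (eq_measure_integral (pushforward mu (-%R : _ -> measurableTypeR R))).
  by rewrite ge0_integral_pushforward.
by move=> A mA _; rewrite /= lebesgue_measureN.
Qed.

Lemma integral_affine (a b : R) f : a != 0%R ->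
  measurable_fun setT f -> (forall x, 0 <= f x) ->
  \int[mu]_x f x = `|a|%:E * \int[mu]_x f (a * x + b)%R.
Proof.
move=> a0 mf f0; have [a_lt0|a_gt0|/eqP] := ltgtP a 0%R; last by rewrite (negbTE a0).
  rewrite (@integral_affine_gt0 (- a) b)// ?oppr_gt0// ltr0_norm//; congr (_ * _).
  rewrite integral_oppr//.
    by apply: eq_integral => x _; rewrite mulrNN.
  by apply: measurableT_comp => //; apply: measurable_funD => //; exact: measurable_funM.
by rewrite (@integral_affine_gt0 a b)// gtr0_norm.
Qed.

End Densities.

Section density_integral.
Context d (T : measurableType d) (R : realType).
Local Open Scope ereal_scope.
Import HBNNSimple.

(** True by definition for indicators, then by linearity and monotone
    convergence. *)
Lemma ge0_integral_density (mu m : {measure set T -> \bar R}) (g : T -> R)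
    (f : T -> \bar R) :
  measurable_fun setT g -> (forall x, (0 <= g x)%R) ->
  (forall A, measurable A -> m A = \int[mu]_(x in A) (g x)%:E) ->
  measurable_fun setT f -> (forall x, 0 <= f x) ->
  \int[m]_x f x = \int[mu]_x (f x * (g x)%:E).
Proof.
move=> mg g0 mE mf f0; have mgE : measurable_fun setT (EFin \o g) by exact/measurable_EFinP.
have indicE_ A : measurable A ->
    \int[m]_x (\1_A x)%:E = \int[mu]_x ((\1_A x)%:E * (g x)%:E).
  move=> mA; rewrite integral_indic// setIT mE// integral_mkcond.
  apply: eq_integral => x _; rewrite patchE indicE.
  by case: ifPn => _; rewrite ?mul1e ?mul0e.
have nnsfunE (h : {nnsfun T >-> R}) :
    \int[m]_x (h x)%:E = \int[mu]_x ((h x)%:E * (g x)%:E).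
  under [LHS]eq_integral do rewrite fimfunE -fsumEFin//.
  rewrite [LHS]ge0_integral_fsum//; last 2 first.
    by move=> r; exact/measurable_EFinP/measurableT_comp.
    by move=> n x _; rewrite EFinM nnfun_muleindic_ge0.
  under [RHS]eq_integral.
    move=> x xD; rewrite fimfunE -fsumEFin// muleC ge0_mule_fsumr; last first.
      by move=> r; rewrite EFinM nnfun_muleindic_ge0.
    over.
  rewrite [RHS]ge0_integral_fsum//; last 2 first.
    move=> r; apply: emeasurable_funM => //.
    by apply/measurable_EFinP; do 2 apply/measurableT_comp => //.
    by move=> n x _; apply: mule_ge0; [rewrite lee_fin|rewrite EFinM nnfun_muleindic_ge0].
  apply: eq_fsbigr => r _; rewrite integralZl_indic_nnsfun// indicE_//.
  have [r0|r0] := leP 0%R r.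
    rewrite -ge0_integralZl//.
    - by apply: eq_integral => x _; rewrite EFinM muleA muleC.
    - apply: emeasurable_funM => //; exact/measurable_EFinP.
    - by move=> x _; rewrite mule_ge0// lee_fin.
  rewrite preimage_nnfun0//; under eq_integral do rewrite indic0 mul0e.
  rewrite integral0 mule0.
  by under eq_integral do rewrite indic0 mulr0 mule0; rewrite integral0.
pose f_ := nnsfun_approx measurableT mf.
transitivity (lim (\int[m]_x (f_ n x)%:E @[n --> \oo])).
  rewrite -monotone_convergence//=.
  - apply: eq_integral => ? /[!inE] xD; apply/esym/cvg_lim => //=.
    exact: cvg_nnsfun_approx.
  - by move=> n; exact/measurable_EFinP/measurable_funTS.
  - by move=> n ? _; rewrite lee_fin.
  - by move=> ? _ ? ? mn; rewrite lee_fin; exact/lefP/nd_nnsfun_approx.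
under eq_fun do rewrite nnsfunE.
rewrite -monotone_convergence//=.
- apply: eq_integral => x /[!inE] xD; apply/cvg_lim => //=.
  under eq_fun do rewrite muleC.
  rewrite muleC; apply: cvgeZl => //; exact: cvg_nnsfun_approx.
- by move=> n; apply: emeasurable_funM => //; exact/measurable_EFinP/measurable_funTS.
- by move=> n ? _; rewrite mule_ge0// lee_fin.
- move=> x _ ? ? mn; rewrite lee_wpmul2r// ?lee_fin//; exact/lefP/nd_nnsfun_approx.
Qed.

End density_integral.

(** * The standard normal distribution *)

Section Gaussian.
Context {R : realType}.
Local Notation mu := (@lebesgue_measure R).
Local Notation phi := (@normal_pdf R 0 1).
Local Notation gam := (@normal_prob R 0 1).
Local Notation k := (@normal_peak R 1).

Lemma std_normal_pdfE (x : R) : phi x = k * expR (- (x ^+ 2 / 2)).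
Proof.
rewrite normal_pdfE ?oner_eq0// /normal_fun subr0 expr1n mulNr.
by congr (_ * expR (- (_ / _))).
Qed.

Lemma std_normal_pdfN (x : R) : phi (- x) = phi x.
Proof. by rewrite !std_normal_pdfE sqrrN. Qed.

Lemma normal_peak1_sqr : k * k = (2 * pi)^-1.
Proof.
have p0 : 0 <= (pi : R) *+ 2 by rewrite pmulrn_lge0 ?pi_ge0.
by rewrite /normal_peak -invfM -expr2 expr1n mul1r sqr_sqrtr// mulr_natl.
Qed.

Lemma std_normal_pdfM (x y : R) :
  phi x * phi y = (2 * pi)^-1 * expR (- ((x ^+ 2 + y ^+ 2) / 2)).
Proof.
rewrite !std_normal_pdfE mulrACA normal_peak1_sqr -expRD; congr (_ * expR _).
by ring.
Qed.

Lemma continuous_std_normal_pdf : continuous phi.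
Proof. by apply: continuous_normal_pdf; rewrite oner_eq0. Qed.

Lemma is_derive_std_normal_pdf (x : R) : is_derive x 1 phi (- x * phi x).
Proof.
have -> : phi = fun y => k * expR (- (y ^+ 2 / 2)).
  by apply/funext => y; rewrite std_normal_pdfE.
apply: is_derive_eq.
by rewrite /GRing.scale /=; field.
Qed.

(** The cumulative distribution function of the standard normal law. *)
Definition Phi (x : R) : R := fine (gam `]-oo, x]).

Lemma PhiE (x : R) : (Phi x)%:E = gam `]-oo, x].
Proof. by rewrite /Phi fineK// fin_num_measure. Qed.

Lemma Phi_ge0 x : 0 <= Phi x.
Proof. exact: fine_ge0. Qed.

Lemma Phi_le1 x : Phi x <= 1.
Proof. by rewrite -lee_fin PhiE probability_le1. Qed.

Lemma Phi_derive (x : R) : derivable Phi x 1 /\ (Phi^`())%classic x = phi x.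
Proof.
apply: (@continuous_FTC1 R phi -oo%O x (x + 1)) => //.
- by rewrite ltrDl.
- by apply: integrableS (integrable_normal_pdf 0 1) => //.
- by rewrite ltNyr.
- exact: continuous_std_normal_pdf.
Qed.

Lemma is_derive_Phi (x : R) : is_derive x 1 Phi (phi x).
Proof. by have [dP <-] := Phi_derive x; rewrite derive1E; exact: derivableP. Qed.

Lemma continuous_Phi : continuous Phi.
Proof.
move=> x; apply: differentiable_continuous; apply/derivable1_diffP.
by have [] := Phi_derive x.
Qed.

Lemma Phi_cvgy : Phi x @[x --> +oo] --> (1 : R).
Proof.
have idm := @isMeasurableFun.Build _ _ (measurableTypeR R) R id
  (@measurable_id _ (measurableTypeR R) setT).
pose idR : {RV gam >-> R} := HB.pack (id : measurableTypeR R -> R) idm.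
apply: fine_cvg; exact: (cvg_cdfy1 idR).
Qed.

Lemma std_normal_pdf_cvgy : phi x @[x --> +oo] --> (0 : R).
Proof.
have H : (k * expR (- (x / 2))) @[x --> +oo] --> (0 : R).
  rewrite -[X in _ --> X](mulr0 k); apply: cvgM; first exact: cvg_cst.
  apply: (cvg_comp (fun x => x / 2) (fun x => expR (- x))); last exact: cvgr_expR.
  by apply/gt0_cvgMly; [rewrite invr_gt0|exact: cvg_id].
apply: (squeeze_cvgr _ (@cvg_cst _ (0 : R) _ _ _) H).
near=> x; rewrite normal_pdf_ge0 std_normal_pdfE /=.
rewrite ler_pM2l ?normal_peak_gt0 ?oner_eq0// ler_expR lerN2 ler_pM2r ?invr_gt0//.
rewrite expr2 ler_peMl//; near: x; exact: nbhs_pinfty_ge.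
Unshelve. all: by end_near. Qed.

Lemma cvgy_addr (f : R -> R) (a l : R) :
  f x @[x --> +oo] --> l -> f (x + a) @[x --> +oo] --> l.
Proof. by move=> fl; apply: cvg_comp fl; exact: cvg_addrr. Qed.

(** A primitive of the integrand is
    - phi (p + a) - a Phi (p + a) - phi (p - a) + a Phi (p - a), because
    phi' (z) = - z phi (z); it vanishes at infinity. *)
Lemma gaussian_first_moment (a : R) :
  (\int[mu]_(p in `[0%R, +oo[) (p * (phi (p + a) + phi (p - a)))%:E =
   (2 * phi a + a * (Phi a - Phi (- a)))%:E)%E.
Proof.
pose F (p : R) := - phi (p + a) - a * Phi (p + a) - phi (p - a) + a * Phi (p - a).
have dF (p : R) : is_derive p 1 F (p * (phi (p + a) + phi (p - a))).
  have d1 (b : R) : is_derive p 1 (fun x => phi (x + b)) (- (p + b) * phi (p + b)).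
    have := is_derive_std_normal_pdf (p + b) => h.
    apply: is_derive_eq.
    by rewrite addr0 mulr1.
  have d2 (b : R) : is_derive p 1 (fun x => Phi (x + b)) (phi (p + b)).
    have := is_derive_Phi (p + b) => h.
    by apply: is_derive_eq; rewrite addr0 mulr1.
  have d1a := d1 a; have d1b := d1 (- a); have d2a := d2 a; have d2b := d2 (- a).
  rewrite /F; apply: is_derive_eq; rewrite /GRing.scale /=; ring.
have Fy : F p @[p --> +oo] --> (0 : R).
  have -> : (0 : R) = - 0 - a * 1 - 0 + a * 1 by ring.
  have c1 := @cvgy_addr _ a _ std_normal_pdf_cvgy.
  have c2 := @cvgy_addr _ (- a) _ std_normal_pdf_cvgy.
  have c3 := @cvgy_addr _ a _ Phi_cvgy.
  have c4 := @cvgy_addr _ (- a) _ Phi_cvgy.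
  apply: cvgD; first apply: cvgB; first apply: cvgB.
  - exact: cvgN.
  - by apply: cvgM => //; exact: cvg_cst.
  - by [].
  - by apply: cvgM => //; exact: cvg_cst.
have F0 : F 0 = - (2 * phi a + a * (Phi a - Phi (- a))).
  by rewrite /F !add0r std_normal_pdfN; ring.
have cont (p : R) : {for p, continuous F}.
  by apply: differentiable_continuous; apply/derivable1_diffP; have := dF p => ?; exact: ex_derive.
rewrite (@ge0_continuous_FTC2y R _ F 0 0) //.
- by rewrite F0 -EFinB opprK add0r.
- by move=> x x0; rewrite mulr_ge0// addr_ge0 ?normal_pdf_ge0.
- apply: continuous_subspaceT => x; apply: cvgM; first exact: cvg_id.
  have ct (b : R) : phi (y + b) @[y --> x] --> phi (x + b).
    apply: (cvg_comp (fun y => y + b) phi); last exact: continuous_std_normal_pdf.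
    by apply: cvgD; [exact: cvg_id|exact: cvg_cst].
  by apply: cvgD; exact: ct.
- by apply: cvg_at_right_filter; exact: cont.
- by move=> x _; have dFx := dF x; rewrite derive1E derive_val.
Qed.
End Gaussian.

(** * The standard Gaussian measure of the plane *)

Section Gauss2.
Context {R : realType}.
Local Notation mu := (@lebesgue_measure R).
Local Notation phi := (@normal_pdf R 0 1).
Local Notation gam := (@normal_prob R 0 1).
Local Open Scope ereal_scope.

Lemma tonelliR (f : R * R -> \bar R) :
  measurable_fun setT f -> (forall z, 0 <= f z) ->
  \int[mu]_x \int[mu]_y f (x, y) = \int[mu]_y \int[mu]_x f (x, y).
Proof.
by move=> mf f0; exact: (@fubini_tonelli _ _ (measurableTypeR R) (measurableTypeR R)).
Qed.

Lemma measurable_intl (f : R * R -> \bar R) :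
  measurable_fun setT f -> (forall z, 0 <= f z) ->
  measurable_fun [set: R] (fun y => \int[mu]_x f (x, y)).
Proof.
move=> mf f0.
exact: (@measurable_fun_fubini_tonelli_G _ _ (measurableTypeR R) (measurableTypeR R) R mu f).
Qed.

Lemma measurable_intr (f : R * R -> \bar R) :
  measurable_fun setT f -> (forall z, 0 <= f z) ->
  measurable_fun [set: R] (fun x => \int[mu]_y f (x, y)).
Proof.
move=> mf f0.
exact: (@measurable_fun_fubini_tonelli_F _ _ (measurableTypeR R) (measurableTypeR R) R mu f).
Qed.

Lemma integral_gauss2 (f : R * R -> \bar R) :
  measurable_fun setT f -> (forall z, 0 <= f z) ->
  \int[gam \x gam]_z f z = \int[mu]_x \int[mu]_y (f (x, y) * (phi x * phi y)%:E).
Proof.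
move=> mf f0; rewrite fubini_tonelli1//.
have mphi : measurable_fun setT phi by exact: measurable_normal_pdf.
have phi0 x : (0 <= phi x)%R by exact: normal_pdf_ge0.
have H (g : R -> \bar R) : measurable_fun setT g -> (forall x, 0 <= g x) ->
    \int[gam]_x g x = \int[mu]_x (g x * (phi x)%:E).
  by move=> mg g0; apply: ge0_integral_density.
rewrite H//; last 2 first.
  exact: measurable_fun_fubini_tonelli_F.
  by move=> x; exact: integral_ge0.
apply: eq_integral => x _; rewrite /fubini_F H//; last first.
  exact: measurableT_comp.
rewrite -ge0_integralZr//=.
- by apply: eq_integral => y _; rewrite EFinM (muleC (phi x)%:E) muleA.
- apply: emeasurable_funM; first exact: measurableT_comp.
  exact/measurable_EFinP.
- by move=> y _; rewrite mule_ge0// lee_fin.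
- by rewrite lee_fin.
Qed.

(** The second coordinate of a rotated point (x, y) in terms of y and of the
    first one, a x - b y: the rotation is a shear in x followed by one in y. *)
Lemma rotation_as_shear (a b x y : R) :
  a != 0%R -> (a ^+ 2 + b ^+ 2 = 1)%R ->
  (b * x + a * y = a^-1 * y + b * (a * x - b * y) / a)%R.
Proof.
move=> a0 ab; have -> : (a^-1 * y = a^-1 * (a ^+ 2 + b ^+ 2) * y)%R.
  by rewrite ab mulr1.
by field.
Qed.

(** For a different from 0 the rotation factors into two affine substitutions
    in one variable each, whose factors 1 / a and a cancel; for a = 0 it is a
    reflection composed with the exchange of the coordinates. *)
Lemma integral_rotation (a b : R) (h : R * R -> \bar R) :
  (a ^+ 2 + b ^+ 2 = 1)%R -> measurable_fun setT h -> (forall z, 0 <= h z) ->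
  \int[mu]_x \int[mu]_y h (a * x - b * y, b * x + a * y)%R =
  \int[mu]_x \int[mu]_y h (x, y).
Proof.
move=> ab mh h0.
rewrite (@tonelliR (fun z => h (a * z.1 - b * z.2, b * z.1 + a * z.2)%R))//; last first.
  apply: measurableT_comp => //; apply: measurable_fun_pair.
    by apply: measurable_funB; apply: measurable_funM.
  by apply: measurable_funD; apply: measurable_funM.
have [a0|a0] := eqVneq a 0%R.
  have b1 : (`|b| = 1)%R.
    move: ab; rewrite a0 expr0n add0r => /eqP.
    by rewrite sqrf_eq1 => /orP[] /eqP ->; rewrite ?normrN normr1.
  have b0 : b != 0%R by rewrite -normr_eq0 b1 oner_eq0.
  transitivity (\int[mu]_y \int[mu]_q h (- b * y, q)%R).
    apply: eq_integral => y _; rewrite [RHS](@integral_affine _ b 0)//.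
      by rewrite b1 mul1e; apply: eq_integral => x _; rewrite a0 !mul0r sub0r mulNr.
    by apply: measurableT_comp.
  rewrite [RHS](@integral_affine _ (- b) 0) ?oppr_eq0//.
  - by rewrite normrN b1 mul1e; apply: eq_integral => y _; rewrite addr0.
  - exact: measurable_intr.
  - by move=> x; exact: integral_ge0.
transitivity (\int[mu]_y (`|a^-1|%:E * \int[mu]_p h (p, a^-1 * y + b * p / a)%R)).
  apply: eq_integral => y _.
  rewrite [X in _ * X](@integral_affine _ a (- (b * y)))//; last first.
    apply: measurableT_comp => //; apply: measurable_fun_pair => //.
    by apply: measurable_funD; do ?apply: measurable_funM.
  rewrite muleA -EFinM normfV mulVf ?normr_eq0// mul1e.
  apply: eq_integral => x _; congr (h (_, _)).
  exact: rotation_as_shear.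
have mb : measurable_fun setT (fun z : R * R => h (z.1, a^-1 * z.2 + b * z.1 / a)%R).
  apply: measurableT_comp => //; apply: measurable_fun_pair => //.
  by apply: measurable_funD; do ?apply: measurable_funM.
rewrite ge0_integralZl//; last 2 first.
- exact: measurable_intl mb _.
- by move=> y _; exact: integral_ge0.
rewrite -(@tonelliR (fun z => h (z.1, a^-1 * z.2 + b * z.1 / a)%R))//.
rewrite -ge0_integralZl//; last 2 first.
- exact: measurable_intr mb _.
- by move=> y _; exact: integral_ge0.
apply: eq_integral => p _; rewrite [RHS](@integral_affine _ a^-1 (b * p / a)) ?invr_eq0//.
by apply: measurableT_comp.
Qed.

Lemma std_normal_pdf_rotation (a b x y : R) : (a ^+ 2 + b ^+ 2 = 1)%R ->
  (phi (a * x - b * y) * phi (b * x + a * y) = phi x * phi y)%R.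
Proof.
move=> ab.
rewrite (std_normal_pdfM (a * x - b * y) (b * x + a * y)) (std_normal_pdfM x y).
suff -> : ((a * x - b * y) ^+ 2 + (b * x + a * y) ^+ 2 = x ^+ 2 + y ^+ 2)%R by [].
transitivity ((a ^+ 2 + b ^+ 2) * (x ^+ 2 + y ^+ 2))%R; first by ring.
by rewrite ab mul1r.
Qed.

(** The density depends only on the norm and Lebesgue measure is invariant. *)
Lemma gauss2_rotation (a b : R) (f : R * R -> \bar R) :
  (a ^+ 2 + b ^+ 2 = 1)%R -> measurable_fun setT f -> (forall z, 0 <= f z) ->
  \int[gam \x gam]_z f (a * z.1 - b * z.2, b * z.1 + a * z.2)%R =
  \int[gam \x gam]_z f z.
Proof.
move=> ab mf f0.
have mphi : measurable_fun setT phi by exact: measurable_normal_pdf.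
have phi0 x : (0 <= phi x)%R by exact: normal_pdf_ge0.
have mr : measurable_fun setT (fun z : R * R => (a * z.1 - b * z.2, b * z.1 + a * z.2)%R).
  apply: measurable_fun_pair.
    by apply: measurable_funB; apply: measurable_funM.
  by apply: measurable_funD; apply: measurable_funM.
have mfr : measurable_fun setT (fun z : R * R => f (a * z.1 - b * z.2, b * z.1 + a * z.2)%R).
  exact: measurableT_comp mf mr.
rewrite (integral_gauss2 mfr); last by [].
rewrite (integral_gauss2 mf f0).
pose g (z : R * R) := f z * (phi z.1 * phi z.2)%:E.
have mg : measurable_fun setT g.
  apply: emeasurable_funM; first exact: mf.
  by apply/measurable_EFinP; apply: measurable_funM; apply: measurableT_comp.
have g0 z : 0 <= g z by rewrite mule_ge0// lee_fin mulr_ge0.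
rewrite -[RHS](integral_rotation ab mg g0).
apply: eq_integral => x _; apply: eq_integral => y _; rewrite /g /=; congr (_ * _%:E).
exact/esym/std_normal_pdf_rotation.
Qed.

Lemma gauss2_linear_form (a b : R) (A : set R) :
  (a ^+ 2 + b ^+ 2 = 1)%R -> measurable A ->
  (gam \x gam) [set z | A (a * z.1 + b * z.2)%R] = gam A.
Proof.
move=> ab mA.
have m1A : measurable [set z : R * R | A z.1].
  by rewrite -[X in measurable X]setTI; exact: measurable_fst.
have ab' : (a ^+ 2 + (- b) ^+ 2 = 1)%R by rewrite sqrrN.
have m2A : measurable [set z : R * R | A (a * z.1 + b * z.2)%R].
  rewrite -[X in measurable X]setTI.
  suff : measurable_fun setT (fun z : R * R => a * z.1 + b * z.2)%R by apply.
  by apply: measurable_funD; apply: measurable_funM.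
transitivity (\int[gam \x gam]_z (\1_[set z : R * R | A z.1] z)%:E).
  have mI : measurable_fun setT (fun z : R * R => (\1_[set z : R * R | A z.1] z : R)%:E).
    exact/measurable_EFinP/measurable_indic.
  rewrite -[RHS](gauss2_rotation ab' mI); last by [].
  rewrite -(setIT [set z | _]) -integral_indic//; apply: eq_integral => z _.
  congr (_%:E); rewrite !indicE; congr (_%:R); congr nat_of_bool.
  by apply/idP/idP; rewrite !inE /= mulNr opprK.
rewrite integral_indic// setIT.
have -> : [set z : R * R | A z.1] = A `*` setT by apply/seteqP; split => z //= [].
transitivity (gam A * gam setT); last by rewrite probability_setT mule1.
exact: product_measure1E.
Qed.
End Gauss2.

Section HalfPlanes.
Context {R : realType}.
Local Notation mu := (@lebesgue_measure R).
Local Notation gam := (@normal_prob R 0 1).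
Local Notation gam2 := (gam \x gam)%E.

(** The signed distance from the origin to the line from x to y, positive when
    the origin is on its left. *)
Definition ray_offset (x y : R * R) : R :=
  (x.1 * y.2 - x.2 * y.1) / Num.sqrt ((y.1 - x.1) ^+ 2 + (y.2 - x.2) ^+ 2).

Lemma normal_prob_set1 (c : R) : gam [set c] = 0%E.
Proof. by rewrite /normal_prob integral_set1. Qed.

Lemma normal_prob_itvNyo (c : R) : gam `]-oo, c[%classic = (Phi c)%:E.
Proof.
rewrite PhiE /normal_prob integral_itv_bndo_bndc//.
by apply/measurable_funTS/measurable_EFinP; exact: measurable_normal_pdf.
Qed.

(** Up to the positive factor d, the distance between x and y, the orientation
    of z is an affine function of a unit linear form of z, whose law is
    standard normal. *)
Lemma gauss2_orient (x y : R * R) (A : set R) : y != x -> measurable A ->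
  exists d : R, 0 < d /\
  gam2 [set z : R * R | A (ray_offset x y - orient x y z / d)] = gam A.
Proof.
move=> yx mA; pose d := Num.sqrt ((y.1 - x.1) ^+ 2 + (y.2 - x.2) ^+ 2).
have d0 : 0 < d.
  rewrite sqrtr_gt0 lt_neqAle addr_ge0 ?sqr_ge0// andbT eq_sym.
  rewrite paddr_eq0 ?sqr_ge0// !sqrf_eq0 !subr_eq0.
  by apply: contra yx => /andP[/eqP y1 /eqP y2];
    rewrite [y]surjective_pairing y1 y2 -surjective_pairing.
exists d; split => //.
have dn : d != 0 by rewrite gt_eqF.
have ab : ((y.2 - x.2) / d) ^+ 2 + (- ((y.1 - x.1) / d)) ^+ 2 = 1.
  have d2 : d ^+ 2 = (y.1 - x.1) ^+ 2 + (y.2 - x.2) ^+ 2.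
    by rewrite sqr_sqrtr// addr_ge0// sqr_ge0.
  by rewrite sqrrN !exprMn -mulrDl addrC -d2 exprVn divff// expf_neq0.
rewrite -(gauss2_linear_form ab mA); congr (gam2 _).
apply/seteqP; split => z /=; suff -> : (ray_offset x y - orient x y z / d =
  (y.2 - x.2) / d * z.1 + - ((y.1 - x.1) / d) * z.2) by [].
all: rewrite /ray_offset -/d /orient; by field.
Qed.

Lemma gauss2_left_side (x y : R * R) : y != x ->
  gam2 [set z : R * R | 0 < orient x y z] = (Phi (ray_offset x y))%:E.
Proof.
move=> yx; have [d [d0 <-]] : exists d : R, 0 < d /\
  gam2 [set z : R * R | `]-oo, ray_offset x y[%classic (ray_offset x y - orient x y z / d)] =
  (Phi (ray_offset x y))%:E.
  by rewrite -normal_prob_itvNyo; exact: gauss2_orient.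
congr (gam2 _); apply/seteqP; split => z /=; rewrite in_itv/= gtrBl.
  by move=> ?; rewrite divr_gt0.
by rewrite pmulr_lgt0// invr_gt0.
Qed.

Lemma gauss2_line (x y : R * R) : y != x ->
  gam2 [set z : R * R | orient x y z = 0] = 0%E.
Proof.
move=> yx; have [d [d0 E]] := @gauss2_orient x y [set ray_offset x y] yx (measurable_set1 _).
rewrite normal_prob_set1 in E; rewrite -[RHS]E.
congr (gam2 _); apply/seteqP; split => z /=; first by move=> ->; rewrite mul0r subr0.
move/eqP; rewrite -subr_eq0 addrAC subrr sub0r oppr_eq0 mulf_eq0 invr_eq0.
by rewrite (gt_eqF d0) orbF => /eqP.
Qed.

Lemma measurable_sqrt : measurable_fun setT (@Num.sqrt R).
Proof. by apply: continuous_measurable_fun; exact: sqrt_continuous. Qed.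

Lemma measurable_invr : measurable_fun setT (@GRing.inv R).
Proof.
have -> : [set: R] = [set 0] `|` ~` [set 0] by rewrite setUv.
apply/measurable_funU => //; first exact: measurableC.
split; first exact: measurable_fun_set1.
apply: open_continuous_measurable_fun; first by apply: closed_openC; exact: closed_eq.
move=> x; rewrite inE /= => /eqP x0; exact: inv_continuous.
Qed.

Lemma measurable_ray_offset (x : R * R) (m : nat) :
  measurable_fun [set: measurableTypeR R * measurableTypeR R]
    (fun y => (Phi (ray_offset x y) ^+ m)%:E).
Proof.
apply/measurable_EFinP; apply: measurable_funX.
have mPhi : measurable_fun setT (@Phi R) by apply: continuous_measurable_fun; exact: continuous_Phi.
apply: (measurableT_comp mPhi); apply: measurable_funM.
  by apply: measurable_funB; apply: measurable_funM.
apply: (measurableT_comp measurable_invr); apply: (measurableT_comp measurable_sqrt).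
by apply: measurable_funD; apply: measurable_funX; apply: measurable_funB.
Qed.

Lemma set1_pair (x : R * R) : [set x] = [set x.1] `*` [set x.2].
Proof. by apply/seteqP; split => [z -> //|[z1 z2] [/= -> ->]]; rewrite -surjective_pairing. Qed.

Lemma measurable_set1_pair (x : measurableTypeR R * measurableTypeR R) : measurable [set x].
Proof. by rewrite set1_pair; apply: measurableX; exact: measurable_set1. Qed.

Lemma gauss2_set1 (x : R * R) : gam2 [set x] = 0%E.
Proof.
rewrite set1_pair.
transitivity (gam [set x.1] * gam [set x.2])%E; last by rewrite normal_prob_set1 mul0e.
exact: product_measure1E.
Qed.

End HalfPlanes.

(** * Polar coordinates *)

Section SlopeSubstitution.
Context {R : realType}.
Local Notation mu := (@lebesgue_measure R).

(** The sine of the angle with slope t. *)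
Definition slope_sin (t : R) : R := t / Num.sqrt (1 + t ^+ 2).
(** The slope of the angle with sine w. *)
Definition slope_tan (w : R) : R := w / Num.sqrt (1 - w ^+ 2).

Lemma sqrt1D_gt0 (t : R) : 0 < Num.sqrt (1 + t ^+ 2).
Proof. by rewrite sqrtr_gt0 ltr_wpDr ?sqr_ge0. Qed.

Lemma is_derive_slope_sin (t : R) :
  is_derive t 1 slope_sin ((Num.sqrt (1 + t ^+ 2)) ^- 3).
Proof.
have q0 := sqrt1D_gt0 t.
have h1 : is_derive (1 + t ^+ 2) 1 Num.sqrt ((2 * Num.sqrt (1 + t ^+ 2))^-1).
  by apply: is_derive1_sqrt; rewrite ltr_wpDr ?sqr_ge0.
have h2 : is_derive t 1 (fun y => Num.sqrt (1 + y ^+ 2)) (t / Num.sqrt (1 + t ^+ 2)).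
  by apply: is_derive_eq; rewrite /GRing.scale/=; field; rewrite gt_eqF.
rewrite /slope_sin.
have h3 : is_derive t 1 (fun y => (Num.sqrt (1 + y ^+ 2))^-1)
    (- (Num.sqrt (1 + t ^+ 2)) ^- 2 *: (t / Num.sqrt (1 + t ^+ 2))).
  by apply: is_deriveV; rewrite gt_eqF.
apply: is_derive_eq; rewrite /GRing.scale/=.
have q2 : Num.sqrt (1 + t ^+ 2) ^+ 2 = 1 + t ^+ 2.
  by rewrite sqr_sqrtr// addr_ge0// sqr_ge0.
apply: (@mulIf _ (Num.sqrt (1 + t ^+ 2) ^+ 3)); first by rewrite gt_eqF// exprn_gt0.
rewrite mulVf; last by rewrite gt_eqF// exprn_gt0.
move: q0 q2; move: (Num.sqrt _) => q q0 q2.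
have -> : (t * (- q ^- 2 * (t / q)) + q^-1 * 1) * q ^+ 3 = q ^+ 2 - t ^+ 2.
  by field; rewrite gt_eqF.
by rewrite q2 addrK.
Qed.

Lemma slope_sin_lt (a b : R) : a < b -> slope_sin a < slope_sin b.
Proof.
move=> ab; have d (x : R) := is_derive_slope_sin x.
have c x : {for x, continuous slope_sin}.
  by apply: differentiable_continuous; apply/derivable1_diffP; have := d x => ?; exact: ex_derive.
apply: (@gtr0_derive1_lt_cc _ slope_sin a b) => //.
- move=> x _; have := d x => ?; rewrite derive1E derive_val.
  by rewrite invr_gt0 exprn_gt0// sqrt1D_gt0.
- by apply: continuous_subspaceT => x; exact: c.
- by rewrite in_itv/= lexx ltW.
- by rewrite in_itv/= lexx ltW.
Qed.

Lemma slope_sin_itv (t : R) : -1 < slope_sin t < 1.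
Proof.
have q0 := sqrt1D_gt0 t.
rewrite -ltr_norml /slope_sin normrM normfV (gtr0_norm q0) ltr_pdivrMr// mul1r.
rewrite -(ltr_pXn2r (n := 2))// ?nnegrE ?ltW// sqr_sqrtr ?addr_ge0 ?sqr_ge0//.
by rewrite real_normK ?num_real// ltrDr.
Qed.

Lemma sqrt1B_slope_sin (t : R) :
  Num.sqrt (1 - slope_sin t ^+ 2) = (Num.sqrt (1 + t ^+ 2))^-1.
Proof.
have q0 := sqrt1D_gt0 t.
have q2 : Num.sqrt (1 + t ^+ 2) ^+ 2 = 1 + t ^+ 2.
  by rewrite sqr_sqrtr// addr_ge0// sqr_ge0.
have -> : 1 - slope_sin t ^+ 2 = ((Num.sqrt (1 + t ^+ 2))^-1) ^+ 2.
  rewrite /slope_sin; move: q0 q2; move: (Num.sqrt _) => q q0 q2.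
  have qn : q != 0 by rewrite gt_eqF.
  have -> : 1 - (t / q) ^+ 2 = (q ^+ 2 - t ^+ 2) / q ^+ 2 by field.
  by rewrite {1}q2 addrK exprVn mul1r.
by rewrite sqrtr_sqr ger0_norm// invr_ge0 ltW.
Qed.

Lemma sqrt1B_gt0 (w : R) : -1 < w < 1 -> 0 < Num.sqrt (1 - w ^+ 2).
Proof.
rewrite -ltr_norml => w1.
by rewrite sqrtr_gt0 subr_gt0 -real_normK ?num_real// expr_lt1.
Qed.

Lemma slope_tanK (w : R) : -1 < w < 1 -> slope_sin (slope_tan w) = w.
Proof.
move=> w1; have c0 := sqrt1B_gt0 w1.
have c2 : Num.sqrt (1 - w ^+ 2) ^+ 2 = 1 - w ^+ 2.
  by rewrite sqr_sqrtr// subr_ge0 -real_normK ?num_real// exprn_ile1// ltW// ltr_norml.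
rewrite /slope_sin /slope_tan; move: c0 c2; move: (Num.sqrt _) => c c0 c2.
have cn : c != 0 by rewrite gt_eqF.
have -> : 1 + (w / c) ^+ 2 = (c^-1) ^+ 2.
  have -> : 1 + (w / c) ^+ 2 = (c ^+ 2 + w ^+ 2) / c ^+ 2 by field.
  by rewrite {1}c2 subrK exprVn mul1r.
by rewrite sqrtr_sqr ger0_norm ?invr_ge0 ?(ltW c0)//; field.
Qed.

Lemma measurable_slope_sin : measurable_fun setT slope_sin.
Proof.
apply: measurable_funM => //; apply: (measurableT_comp measurable_invr).
apply: (measurableT_comp measurable_sqrt); by apply: measurable_funD.
Qed.

Lemma measurable_slope_tan : measurable_fun setT slope_tan.
Proof.
apply: measurable_funM => //; apply: (measurableT_comp measurable_invr).
apply: (measurableT_comp measurable_sqrt); by apply: measurable_funB.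
Qed.

Lemma derivable_LRcontinuous (f : R -> R) (a b : R) :
  (forall x, derivable f x 1) -> derivable_oo_LRcontinuous f a b.
Proof.
move=> df; have cf x : {for x, continuous f}.
  by apply: differentiable_continuous; apply/derivable1_diffP.
split; first by move=> x _.
- by apply: cvg_at_right_filter; exact: cf.
- by apply: cvg_at_left_filter; exact: cf.
Qed.

Local Open Scope ereal_scope.

(** The image by [slope_tan] of Lebesgue measure on ]-1, 1[ has density the
    derivative of [slope_sin]; this handles an integrand that is only
    measurable. *)
Lemma slope_sin_substitution (h : R -> \bar R) : measurable_fun setT h ->
  (forall w, 0 <= h w) ->
  \int[mu]_(w in `](-1)%R, 1%R[) h w =
  \int[mu]_t (h (slope_sin t) * ((Num.sqrt (1 + t ^+ 2)) ^- 3)%:E).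
Proof.
move=> mh h0.
pose D : set (measurableTypeR R) := `](-1)%R, 1%R[%classic.
have mD : measurable D by exact: measurable_itv.
pose tau : measurableTypeR R -> measurableTypeR R := slope_tan.
have mtau : measurable_fun setT tau by exact: measurable_slope_tan.
pose g (t : R) : R := ((Num.sqrt (1 + t ^+ 2)) ^- 3)%R.
have mg : measurable_fun setT g.
  apply: (measurableT_comp measurable_invr); apply: measurable_funX.
  by apply: (measurableT_comp measurable_sqrt); apply: measurable_funD.
have g0 t : (0 <= g t)%R by rewrite invr_ge0 exprn_ge0// sqrtr_ge0.
have cg : continuous g.
  move=> t; apply: cvgV; first by rewrite gt_eqF// exprn_gt0// sqrt1D_gt0.
  apply: (cvg_comp (fun t => Num.sqrt (1 + t ^+ 2)) (fun q : R => q ^+ 3))%R;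
    last exact: exprn_continuous.
  apply: (cvg_comp (fun t => 1 + t ^+ 2)%R); last exact: sqrt_continuous.
  by apply: cvgD; [exact: cvg_cst|exact: exprn_continuous].
pose m := pushforward (mrestr mu mD) tau.
have mE (a b : R) : (a < b)%R -> m `]a, b]%classic = (slope_sin b - slope_sin a)%:E.
  move=> ab; rewrite /m /pushforward /mrestr.
  have -> : tau @^-1` `]a, b]%classic `&` D = `]slope_sin a, slope_sin b]%classic.
    have sle : {mono slope_sin : x y / (x <= y)%R}.
      by apply: le_mono => x y; exact: slope_sin_lt.
    have slt := leW_mono sle.
    have tauE (x : R) : (-1 < x < 1)%R ->
        (a < slope_tan x <= b)%R = (slope_sin a < x <= slope_sin b)%R.
      by move=> x1; rewrite -[in RHS](slope_tanK x1) slt sle.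
    apply/seteqP; split => x /=; rewrite /D /= !in_itv/=.
      by move=> [+ x1]; rewrite /tau tauE.
    move=> abx; have /andP[ax xb] := abx.
    have x1 : (-1 < x < 1)%R.
      have /andP[a1 _] := slope_sin_itv a; have /andP[_ b1] := slope_sin_itv b.
      by rewrite (lt_trans a1)// (le_lt_trans xb).
    by rewrite /tau tauE.
  by rewrite lebesgue_measure_itv/= lte_fin slope_sin_lt// EFinB.
have dens A : measurable A -> m A = \int[mu]_(x in A) (g x)%:E.
  apply: density_unique => //.
  - by move=> a b ab; apply: (le_lt_trans (y := m `]a, b]%classic)) => //; rewrite mE// ltry.
  - move=> a b ab; rewrite [LHS](mE _ _ ab) integral_itv_obnd_cbnd.
      rewrite (@continuous_FTC2 _ g slope_sin a b)//.
      + exact: continuous_subspaceT.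
      + by apply: derivable_LRcontinuous => x; have := is_derive_slope_sin x => ?; exact: ex_derive.
      + by move=> x _; have := is_derive_slope_sin x => ?; rewrite derive1E derive_val.
    by apply/measurable_EFinP; exact: measurable_funTS.
transitivity (\int[m]_t h (slope_sin t)).
  have mhs : measurable_fun setT (h \o slope_sin).
    exact: measurableT_comp mh measurable_slope_sin.
  rewrite /m ge0_integral_pushforward//= preimage_setT.
  have restrE A : measurable A -> mrestr mu mD A = \int[mu]_(x in A) (\1_D x)%:E.
    by move=> mA; rewrite integral_indic// setIC.
  rewrite (@ge0_integral_density _ _ R mu (mrestr mu mD) (\1_D) _ _ _ restrE)//.
  - rewrite [LHS]integral_mkcond; apply: eq_integral => w _; rewrite patchE indicE /D.
    case: ifPn => [|_]; last by rewrite mule0.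
    by rewrite inE /= in_itv/= => w1; rewrite mule1 slope_tanK.
  - exact: measurableT_comp mhs mtau.
rewrite [LHS](@ge0_integral_density _ (measurableTypeR R) R mu
  (pushforward (mrestr mu mD) tau) g _ mg g0 dens)//.
exact: measurableT_comp mh measurable_slope_sin.
Qed.

End SlopeSubstitution.

Section PolarCoordinates.
Context {R : realType}.
Local Notation mu := (@lebesgue_measure R).
Local Open Scope ereal_scope.

(** The integral of f in polar coordinates over the two directions with sine
    w; the maximum with 0 restricts p to the positive half-line. *)
Definition radial (f : R * R -> \bar R) (w : R) : \bar R :=
  \int[mu]_p ((Num.max p 0)%:E *
    (f (p * Num.sqrt (1 - w ^+ 2), p * w)%R + f (- (p * Num.sqrt (1 - w ^+ 2)), p * w)%R)).

Lemma measurable_max0 : measurable_fun [set: R] (fun p : R => (Num.max p 0)%R).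
Proof. exact: measurable_maxr. Qed.

Lemma measurable_radial_integrand (f : R * R -> \bar R) : measurable_fun setT f ->
  measurable_fun [set: R * R] (fun z : R * R => (Num.max z.1 0)%:E *
    (f (z.1 * Num.sqrt (1 - z.2 ^+ 2), z.1 * z.2)%R +
     f (- (z.1 * Num.sqrt (1 - z.2 ^+ 2)), z.1 * z.2)%R)).
Proof.
move=> mf.
have mc : measurable_fun [set: R * R] (fun z : R * R => z.1 * Num.sqrt (1 - z.2 ^+ 2))%R.
  apply: measurable_funM => //; apply: (measurableT_comp measurable_sqrt).
  by apply: measurable_funB => //; exact: measurable_funX.
have mz : measurable_fun [set: R * R] (fun z : R * R => z.1 * z.2)%R.
  exact: measurable_funM.
apply: emeasurable_funM.
  by apply/measurable_EFinP; exact: (measurableT_comp measurable_max0).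
apply: emeasurable_funD; apply: (measurableT_comp mf); apply: measurable_fun_pair => //.
by apply: measurableT_comp.
Qed.

Lemma measurable_radial (f : R * R -> \bar R) : measurable_fun setT f ->
  (forall z, 0 <= f z) -> measurable_fun [set: R] (radial f).
Proof.
move=> mf f0; apply: (measurable_intl (measurable_radial_integrand mf)).
by move=> z; rewrite mule_ge0// ?adde_ge0// lee_fin le_max lexx orbT.
Qed.

Lemma radial_ge0 (f : R * R -> \bar R) w : (forall z, 0 <= f z) -> 0 <= radial f w.
Proof.
move=> f0; apply: integral_ge0 => p _.
by rewrite mule_ge0// ?adde_ge0// lee_fin le_max lexx orbT.
Qed.

Lemma integral_fold (K : R -> \bar R) : measurable_fun setT K ->
  (forall x, 0 <= K x) ->
  \int[mu]_x K x = \int[mu]_(x in `]0%R, +oo[) (K x + K (- x)%R).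
Proof.
move=> mK K0.
have mKN : measurable_fun [set: R] (fun x : R => K (- x)%R) by exact: measurableT_comp.
rewrite [RHS]ge0_integralD//; last 2 first.
- exact: measurable_funTS.
- exact: measurable_funTS.
have UE : [set: R] = `]0%R, +oo[%classic `|` `]-oo, 0%R]%classic.
  by apply/seteqP; split => x //= _; rewrite !in_itv/= andbT; case: (ltP 0%R x) => ?; [left|right].
have -> : \int[mu]_x K x = \int[mu]_(x in `]0%R, +oo[ `|` `]-oo, 0%R]) K x by rewrite -UE.
rewrite ge0_integral_setU//; last 2 first.
- by rewrite -UE.
- by apply/disj_setPS => x [] /=; rewrite !in_itv/= andbT leNgt => ->.
congr (_ + _); rewrite [RHS]integral_itv_obnd_cbnd; last exact: measurable_funTS.
rewrite ge0_integration_by_substitution0//.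
by apply: eq_integral => x _; rewrite opprK.
Qed.

Lemma arcsine_pdf_ge0 (w : R) : (0 <= arcsine_pdf w)%R.
Proof.
rewrite /arcsine_pdf; case: ifP => // _.
by rewrite mulr_ge0// invr_ge0 ?pi_ge0 ?sqrtr_ge0.
Qed.

Lemma pi_arcsine_pdf (w : R) : (pi * arcsine_pdf w =
  if (-1 < w < 1) then (Num.sqrt (1 - w ^+ 2))^-1 else 0)%R.
Proof.
rewrite /arcsine_pdf; case: (boolP (-1 < w < 1)%R) => [/andP[w1 w2]|].
  by rewrite !ltW//= mulrA divff ?mul1r// gt_eqF ?pi_gt0.
case: (boolP (-1 <= w <= 1)%R) => [/andP[w1 w2]|_ _]; last by rewrite mulr0.
rewrite !lt_neqAle w1 w2 !andbT negb_and !negbK => /orP[/eqP <-|/eqP ->].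
  by rewrite sqrrN expr1n subrr sqrtr0 invr0 !mulr0.
by rewrite expr1n subrr sqrtr0 invr0 !mulr0.
Qed.

(** With y = |x| t, then x = p / q and w = t / q for q = sqrt (1 + t^2), the
    area element |x| dx dt becomes p dp dw / sqrt (1 - w^2), in which the
    arcsine density appears as the weight of the sine w of the angle. *)
Lemma polar (f : R * R -> \bar R) : measurable_fun setT f ->
  (forall z, 0 <= f z) ->
  \int[mu]_x \int[mu]_y f (x, y) =
  \int[mu]_w ((pi * arcsine_pdf w)%:E * radial f w).
Proof.
move=> mf f0.
pose G (z : R * R) := (Num.max z.1 0)%:E *
  (f (z.1, z.1 * z.2)%R + f (- z.1, z.1 * z.2)%R).
have mG : measurable_fun setT G.
  apply: emeasurable_funM.
    by apply/measurable_EFinP; exact: (measurableT_comp measurable_max0).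
  have mz : measurable_fun [set: R * R] (fun z : R * R => z.1 * z.2)%R.
    exact: measurable_funM.
  apply: emeasurable_funD; apply: (measurableT_comp mf); apply: measurable_fun_pair => //.
  by apply: measurableT_comp.
have G0 z : 0 <= G z by rewrite mule_ge0// ?adde_ge0// lee_fin le_max lexx orbT.
have mfx x : measurable_fun [set: R] (fun y : R => f (x, y)).
  by apply: (measurableT_comp mf); exact: measurable_fun_pair.
have mfxM (x z : R) : measurable_fun [set: R] (fun y : R => f (x, z * y)%R).
  by apply: (measurableT_comp mf); apply: measurable_fun_pair.
transitivity (\int[mu]_x \int[mu]_t G (x, t)).
  rewrite integral_fold; last 2 first.
  - exact: measurable_intr.
  - by move=> x; apply: integral_ge0.
  rewrite integral_mkcond; apply: eq_integral => x _; rewrite patchE.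
  case: ifPn; last first.
    move=> /negP; rewrite inE/= in_itv/= andbT => /negP; rewrite -leNgt => x0.
    by apply/esym/integral0_eq => t _; rewrite /G /= max_r// mul0e.
  rewrite inE/= in_itv/= andbT => x0.
  have E (z : R) : \int[mu]_y f (z, y) = x%:E * \int[mu]_t f (z, x * t)%R.
    rewrite (@integral_affine_gt0 _ x 0)//; congr (_ * _).
    by apply: eq_integral => t _; rewrite addr0.
  rewrite !E /G /= max_l ?(ltW x0)//.
  rewrite ge0_integralZl//=; last 3 first.
  - by apply: emeasurable_funD; exact: mfxM.
  - by move=> t _; rewrite adde_ge0//.
  - by rewrite lee_fin ltW.
  rewrite ge0_integralD//=; last 2 first.
  - exact: mfxM.
  - exact: mfxM.
  by apply/esym/ge0_muleDr; apply: integral_ge0 => t _; exact: f0.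
rewrite (tonelliR mG G0).
(* Of the factor q^-2 of the substitution x = p / q, the part q^-3 is the
   derivative of the sine; h takes the remaining q = 1 / sqrt (1 - w^2). *)
pose h (w : R) := (Num.sqrt (1 - w ^+ 2))^-1%:E * radial f w.
transitivity (\int[mu]_t (h (slope_sin t) * ((Num.sqrt (1 + t ^+ 2)) ^- 3)%:E)).
  apply: eq_integral => t _.
  have q0 := sqrt1D_gt0 t.
  rewrite (@integral_affine_gt0 _ (Num.sqrt (1 + t ^+ 2))^-1 0) ?invr_gt0//; last first.
    by apply: (measurableT_comp mG); exact: measurable_fun_pair.
  rewrite /h sqrt1B_slope_sin invrK /radial sqrt1B_slope_sin.
  set q := Num.sqrt _ in q0 *.
  have qV0 : (0 <= q^-1)%R by rewrite invr_ge0 ltW.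
  rewrite muleAC -EFinM.
  have -> : (q * q ^- 3 = q^-1 * q^-1)%R by field; rewrite gt_eqF.
  rewrite EFinM -muleA; congr (_ * _).
  rewrite -ge0_integralZl//; last 2 first.
  - have mp : measurable_fun [set: R] (fun p : R => (p, slope_sin t)).
      exact: measurable_fun_pair.
    have := measurableT_comp (measurable_radial_integrand mf) mp.
    by rewrite /comp /= sqrt1B_slope_sin.
  - by move=> p _; rewrite mule_ge0// ?adde_ge0// lee_fin le_max lexx orbT.
  apply: eq_integral => p _; rewrite /G /= addr0 muleA -EFinM.
  congr (_%:E * (f (_, _) + f (_, _))).
  - by rewrite maxr_pMr// mulr0.
  - by rewrite mulrC.
  - by rewrite /slope_sin -/q; ring.
  - by rewrite mulrC.
  - by rewrite /slope_sin -/q; ring.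
rewrite -slope_sin_substitution.
- rewrite integral_mkcond; apply: eq_integral => w _; rewrite patchE pi_arcsine_pdf /h.
  case: ifPn => [|/negP]; rewrite inE /= in_itv/= => w1; first by rewrite w1.
  by case: ifPn => // _; rewrite mul0e.
- apply: emeasurable_funM; last exact: measurable_radial.
  apply/measurable_EFinP; apply: (measurableT_comp measurable_invr).
  apply: (measurableT_comp measurable_sqrt).
  by apply: measurable_funB.
- by move=> w; rewrite mule_ge0// ?radial_ge0// lee_fin invr_ge0 sqrtr_ge0.
Qed.
End PolarCoordinates.

Section ArcsineWeights.
Context {R : realType}.
Local Notation mu := (@lebesgue_measure R).
Local Notation phi := (@normal_pdf R 0 1).
Local Notation gam := (@normal_prob R 0 1).
Local Notation k := (@normal_peak R 1).
Local Notation co w := (Num.sqrt (1 - w ^+ 2)).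

(** The formula needs no case distinction: beyond -1 and 1 the square root,
    hence its inverse, is 0. *)
Lemma arcsine_pdfE (w : R) : arcsine_pdf w = pi^-1 * (co w)^-1.
Proof.
rewrite /arcsine_pdf; case: ifP => //; rewrite -ler_norml => /negbT; rewrite -ltNge => w1.
rewrite ler0_sqrtr ?invr0 ?mulr0// subr_le0 -[leRHS]real_normK ?num_real//.
by rewrite exprn_ege1// ltW.
Qed.

Lemma pi_arcsine_pdfE (w : R) : pi * arcsine_pdf w = (co w)^-1.
Proof. by rewrite arcsine_pdfE mulrA divff ?mul1r// gt_eqF ?pi_gt0. Qed.

Lemma measurable_co : measurable_fun [set: R] (fun w : R => co w).
Proof. by apply: (measurableT_comp measurable_sqrt); apply: measurable_funB. Qed.

Lemma measurable_arcsine_pdf : measurable_fun setT (@arcsine_pdf R).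
Proof.
rewrite (_ : @arcsine_pdf R = fun w => pi^-1 * (co w)^-1); last first.
  by apply/funext => w; exact: arcsine_pdfE.
apply: measurable_funM => //; apply: (measurableT_comp measurable_invr).
exact: measurable_co.
Qed.

Lemma measurable_Phi : measurable_fun setT (@Phi R).
Proof. by apply: continuous_measurable_fun; exact: continuous_Phi. Qed.

Lemma measurable_phi : measurable_fun setT phi.
Proof. exact: measurable_normal_pdf. Qed.

Lemma measurable_phiD (a : R) : measurable_fun [set: R] (fun p : R => phi (p + a)).
Proof. by apply: (measurableT_comp measurable_phi); apply: measurable_funD. Qed.

Local Open Scope ereal_scope.

Lemma integral_max0 (g : R -> R) :
  \int[mu]_p ((Num.max p 0 * g p)%:E) = \int[mu]_(p in `[0%R, +oo[) ((p * g p)%:E).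
Proof.
rewrite [RHS]integral_mkcond; apply: eq_integral => p _; rewrite patchE.
case: ifPn => [|/negP]; rewrite inE/= in_itv/= andbT.
  by move=> p0; rewrite max_l.
by move=> /negP; rewrite -ltNge => p0; rewrite max_r ?mul0r ?ltW.
Qed.

Lemma first_moment_max0 (a : R) :
  \int[mu]_p ((Num.max p 0 * (phi (p + a) + phi (p - a)))%:E) =
  (2 * phi a + a * (Phi a - Phi (- a)))%:E.
Proof. by rewrite integral_max0 gaussian_first_moment. Qed.

Lemma co_sqr (w : R) : (-1 < w < 1)%R -> (co w ^+ 2 = 1 - w ^+ 2)%R.
Proof.
move=> w1; rewrite sqr_sqrtr// subr_ge0 -real_normK ?num_real// exprn_ile1//.
by rewrite ltW// ltr_norml.
Qed.

Lemma polar_eq (f : R * R -> \bar R) (rad : R -> \bar R) :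
  measurable_fun setT f -> (forall z, 0 <= f z) ->
  (forall w, (-1 < w < 1)%R -> radial f w = rad w) ->
  \int[mu]_x \int[mu]_y f (x, y) =
  \int[mu]_w ((pi * arcsine_pdf w)%:E * rad w).
Proof.
move=> mf f0 fr; rewrite polar//; apply: eq_integral => w _.
rewrite pi_arcsine_pdf; case: ifPn => [w1|_]; last by rewrite !mul0e.
by rewrite fr.
Qed.

(** Polar coordinates applied to the Gaussian density itself. *)
Lemma integral_arcsine_pdf : \int[mu]_w (arcsine_pdf w)%:E = 1.
Proof.
have mphi := measurable_phi.
pose f (z : R * R) := (phi z.1 * phi z.2)%:E.
have mf : measurable_fun setT f.
  apply/measurable_EFinP; apply: measurable_funM; exact: measurableT_comp.
have f0 z : 0 <= f z by rewrite lee_fin mulr_ge0// normal_pdf_ge0.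
have tot : \int[mu]_x \int[mu]_y f (x, y) = 1.
  transitivity (\int[gam \x gam]_(z in [set: R * R]) (cst 1 z : \bar R)).
    rewrite (@integral_gauss2 R (cst 1))//.
    by apply: eq_integral => x _; apply: eq_integral => y _; rewrite mul1e.
  rewrite integral_cst// mul1e; exact: probability_setT.
rewrite -tot (@polar_eq f (cst (pi^-1)%:E))//.
  apply: eq_integral => w _; rewrite -EFinM mulrAC mulfV ?mul1r//.
  by rewrite gt_eqF ?pi_gt0.
move=> w w1; rewrite /radial.
transitivity (\int[mu]_p ((Num.max p 0 * (phi (p + 0) + phi (p - 0)))%:E * k%:E)).
  apply: eq_integral => p _; rewrite /f /= -EFinD -!EFinM addr0 subr0; congr (_%:E).
  rewrite (std_normal_pdfN (p * co w)) -mulrA; congr (_ * _)%R.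
  rewrite (std_normal_pdfM (p * co w) (p * w)) (std_normal_pdfE p).
  have -> : ((p * co w) ^+ 2 + (p * w) ^+ 2 = p ^+ 2)%R.
    by rewrite !exprMn co_sqr//; ring.
  by rewrite -normal_peak1_sqr; ring.
rewrite ge0_integralZr//; last 3 first.
- apply/measurable_EFinP; apply: measurable_funM; first exact: measurable_max0.
  by apply: measurable_funD; exact: measurable_phiD.
- by move=> p _; rewrite lee_fin mulr_ge0 ?addr_ge0 ?normal_pdf_ge0// le_max lexx orbT.
- by rewrite lee_fin normal_peak_ge0.
rewrite first_moment_max0 oppr0 subrr mulr0 addr0 -EFinM; congr (_%:E).
rewrite (std_normal_pdfE 0) expr0n mul0r oppr0 expR0 mulr1 -mulrA normal_peak1_sqr.
by rewrite invfM mulrA divff ?mul1r// pnatr_eq0.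
Qed.

End ArcsineWeights.

(** * The Gaussian integrals over a disk and around a point *)

Section Disk.
Context {R : realType}.
Local Notation mu := (@lebesgue_measure R).
Local Notation phi := (@normal_pdf R 0 1).
Local Notation gam := (@normal_prob R 0 1).
Local Notation co w := (Num.sqrt (1 - w ^+ 2)).
Variable N : nat.

(** The expectation of Phi (r W)^N for W with the arcsine law, which is also
    the probability that N independent normal variables are at most r W. *)
Definition arcsine_mean (r : R) : R :=
  fine (\int[mu]_w (Phi (r * w) ^+ N * arcsine_pdf w)%:E)%E.

(** The density of the maximum of N + 1 independent standard normal
    variables. *)
Definition max_pdf (y : R) : R := N.+1%:R * Phi y ^+ N * phi y.

(** The probability that the square of that maximum plus the square of an
    independent normal variable is at most r^2. *)
Definition disk_mass (r : R) : \bar R :=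
  (\int[mu]_x \int[mu]_y ((x ^+ 2 + y ^+ 2 <= r ^+ 2)%R%:R * (phi x * max_pdf y))%:E)%E.

Lemma measurable_PhiX (r : R) : measurable_fun [set: R] (fun w : R => Phi (r * w) ^+ N).
Proof.
apply: measurable_funX; apply: (measurableT_comp measurable_Phi).
exact: measurable_funM.
Qed.

Lemma PhiX_ge0 (x : R) : 0 <= Phi x ^+ N.
Proof. by rewrite exprn_ge0// Phi_ge0. Qed.

Lemma PhiX_le1 (x : R) : Phi x ^+ N <= 1.
Proof. by rewrite exprn_ile1// ?Phi_ge0 ?Phi_le1. Qed.

Lemma measurable_max_pdf : measurable_fun setT max_pdf.
Proof.
apply: measurable_funM; last exact: measurable_phi.
apply: measurable_funM => //; apply: measurable_funX; exact: measurable_Phi.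
Qed.

Lemma max_pdf_ge0 y : 0 <= max_pdf y.
Proof. by rewrite /max_pdf mulr_ge0 ?normal_pdf_ge0// mulr_ge0 ?PhiX_ge0. Qed.

Lemma measurable_leR d (T : measurableType d) (f : T -> R) (c : R) :
  measurable_fun setT f -> measurable_fun setT (fun z => ((f z <= c)%R%:R : R)).
Proof.
move=> mf; rewrite (_ : (fun z => _) = \1_(f @^-1` `]-oo, c])); last first.
  by apply/funext => z; rewrite indicE; congr (nat_of_bool _)%:R;
    apply/idP/idP; rewrite inE/= in_itv.
by apply: measurable_indic; rewrite -[X in measurable X]setTI; exact: mf.
Qed.

Lemma measurable_sqr_le (r : R) :
  measurable_fun [set: R * R] (fun z : R * R => ((z.1 ^+ 2 + z.2 ^+ 2 <= r ^+ 2)%R%:R : R)).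
Proof.
by apply: measurable_leR; apply: measurable_funD; apply: measurable_funX.
Qed.

Local Open Scope ereal_scope.

Lemma arcsine_meanE (r : R) :
  (arcsine_mean r)%:E = \int[mu]_w (Phi (r * w) ^+ N * arcsine_pdf w)%:E.
Proof.
rewrite /arcsine_mean fineK// ge0_fin_numE.
  apply: (@le_lt_trans _ _ (\int[mu]_w (arcsine_pdf w)%:E)); last first.
    by rewrite integral_arcsine_pdf ltry.
  apply: ge0_le_integral => //.
  - by move=> w _; rewrite lee_fin mulr_ge0 ?PhiX_ge0 ?arcsine_pdf_ge0.
  - apply/measurable_EFinP; apply: measurable_funM; first exact: measurable_PhiX.
    exact: measurable_arcsine_pdf.
  - by apply/measurable_EFinP; exact: measurable_arcsine_pdf.
  - by move=> w _; rewrite lee_fin ler_piMl ?arcsine_pdf_ge0 ?PhiX_le1.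
by apply: integral_ge0 => w _; rewrite lee_fin mulr_ge0 ?PhiX_ge0 ?arcsine_pdf_ge0.
Qed.

Lemma arcsine_mean_ge0 r : (0 <= arcsine_mean r)%R.
Proof.
by apply: fine_ge0; apply: integral_ge0 => w _; rewrite lee_fin mulr_ge0 ?PhiX_ge0 ?arcsine_pdf_ge0.
Qed.

(** The integrands are dominated by the arcsine density. *)
Lemma continuous_arcsine_mean : continuous arcsine_mean.
Proof.
move=> r.
have ia : mu.-integrable setT (EFin \o @arcsine_pdf R).
  apply/integrableP; split; first by apply/measurable_EFinP; exact: measurable_arcsine_pdf.
  under eq_integral do rewrite /= ger0_norm ?arcsine_pdf_ge0//.
  by rewrite integral_arcsine_pdf ltry.
apply: (@continuity_under_integral R _ (measurableTypeR R) mu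
  (fun r w => Phi (r * w) ^+ N * arcsine_pdf w)%R setT measurableT (r - 1)%R (r + 1)%R
  _ _ (@arcsine_pdf R) ia).
- move=> x _; apply: le_integrable ia => //.
    apply/measurable_EFinP; apply: measurable_funM; first exact: measurable_PhiX.
    exact: measurable_arcsine_pdf.
  move=> w _ /=; rewrite lee_fin ger0_norm ?mulr_ge0 ?PhiX_ge0 ?arcsine_pdf_ge0//.
  by rewrite ger0_norm ?arcsine_pdf_ge0// ler_piMl ?arcsine_pdf_ge0 ?PhiX_le1.
- apply: aeW => w _ x _; apply: cvgM; last exact: cvg_cst.
  apply: (cvg_comp (fun x => Phi (x * w))%R (fun q : R => q ^+ N)%R); last exact: exprn_continuous.
  apply: (cvg_comp (fun x => x * w)%R); last exact: continuous_Phi.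
  by apply: cvgM; [exact: cvg_id|exact: cvg_cst].
- move=> x _; apply: aeW => w _.
  rewrite ger0_norm ?mulr_ge0 ?PhiX_ge0 ?arcsine_pdf_ge0//.
  by rewrite ler_piMl ?arcsine_pdf_ge0 ?PhiX_le1.
- by rewrite inE/= in_itv/= ltrBlDr ltrDl ltr01.
Qed.

(** Polar coordinates centred at the origin; the factor Phi (p w)^N is all that
    depends on the direction. *)
Lemma disk_mass_polar (r : R) : (0 <= r)%R -> disk_mass r =
  \int[mu]_(p in `[0%R, r]) (p * expR (- (p ^+ 2 / 2)) * (N.+1%:R * arcsine_mean p))%:E.
Proof.
move=> r0.
pose f (z : R * R) := ((z.1 ^+ 2 + z.2 ^+ 2 <= r ^+ 2)%R%:R * (phi z.1 * max_pdf z.2))%:E.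
have mf : measurable_fun setT f.
  apply/measurable_EFinP; apply: measurable_funM; first exact: measurable_sqr_le.
  apply: measurable_funM; first exact: (measurableT_comp measurable_phi).
  exact: (measurableT_comp measurable_max_pdf).
have f0 z : 0 <= f z by rewrite lee_fin mulr_ge0// mulr_ge0 ?normal_pdf_ge0 ?max_pdf_ge0.
pose e (p : R) : R := (Num.max p 0 * (p ^+ 2 <= r ^+ 2)%R%:R * (expR (- (p ^+ 2 / 2)) * N.+1%:R))%R.
have e0 p : (0 <= e p)%R.
  by rewrite /e !mulr_ge0 ?expR_ge0// le_max lexx orbT.
have me : measurable_fun setT e.
  apply: measurable_funM; first apply: measurable_funM.
  - exact: measurable_max0.
  - by apply: measurable_leR; exact: measurable_funX.
  apply: measurable_funM => //; apply: measurableT_comp => //.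
  by apply: measurableT_comp => //; apply: measurable_funM => //; exact: measurable_funX.
pose g (z : R * R) := (arcsine_pdf z.1 * (e z.2 * Phi (z.2 * z.1) ^+ N))%:E.
have mg : measurable_fun setT g.
  apply/measurable_EFinP; apply: measurable_funM.
    exact: (measurableT_comp measurable_arcsine_pdf).
  apply: measurable_funM; first exact: (measurableT_comp me).
  apply: measurable_funX; apply: (measurableT_comp measurable_Phi).
  exact: measurable_funM.
have g0 z : 0 <= g z.
  rewrite lee_fin; apply: mulr_ge0; first exact: arcsine_pdf_ge0.
  by apply: mulr_ge0; [exact: e0|exact: PhiX_ge0].
have mgw w : measurable_fun [set: R] (fun p => (e p * Phi (p * w) ^+ N)%R).
  apply: measurable_funM; first exact: me.
  apply: measurable_funX; apply: (measurableT_comp measurable_Phi).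
  exact: measurable_funM.
have -> : disk_mass r = \int[mu]_w \int[mu]_p g (w, p).
  rewrite -[LHS]/(\int[mu]_x \int[mu]_y f (x, y)).
  rewrite (polar_eq (rad := fun w => \int[mu]_p (pi^-1 * (e p * Phi (p * w) ^+ N))%:E) mf f0).
    apply: eq_integral => w _; rewrite -ge0_integralZl//.
    - apply: eq_integral => p _; rewrite /g -EFinM /=; congr (_%:E).
      by rewrite mulrACA mulfV ?mul1r// gt_eqF ?pi_gt0.
    - apply/measurable_EFinP; apply: measurable_funM; first exact: measurable_cst.
      exact: mgw.
    - move=> p _; rewrite lee_fin; apply: mulr_ge0; first by rewrite invr_ge0 pi_ge0.
      by apply: mulr_ge0; [exact: e0|exact: PhiX_ge0].
    - by rewrite lee_fin mulr_ge0 ?pi_ge0 ?arcsine_pdf_ge0.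
  move=> w w1; apply: eq_integral => p _; rewrite /f /=.
  have -> : ((p * co w) ^+ 2 + (p * w) ^+ 2 = p ^+ 2)%R.
    by rewrite !exprMn co_sqr//; ring.
  rewrite sqrrN.
  have -> : ((p * co w) ^+ 2 + (p * w) ^+ 2 = p ^+ 2)%R.
    by rewrite !exprMn co_sqr//; ring.
  rewrite (std_normal_pdfN (p * co w)) -EFinD -EFinM; congr (_%:E).
  have -> : (phi (p * co w) * max_pdf (p * w) =
     N.+1%:R * Phi (p * w) ^+ N * ((2 * pi)^-1 * expR (- (p ^+ 2 / 2))))%R.
    have -> : (p ^+ 2 = (p * co w) ^+ 2 + (p * w) ^+ 2)%R.
      by rewrite !exprMn co_sqr//; ring.
    rewrite -(std_normal_pdfM (p * co w) (p * w)) /max_pdf; ring.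
  rewrite invfM /e; move: (pi^-1)%R (expR _) (Phi _ ^+ N)%R (Num.max p 0)%R => q E F m.
  by field.
rewrite tonelliR// [RHS]integral_mkcond; apply: eq_integral => p _; rewrite patchE /g /=.
transitivity (\int[mu]_w ((e p)%:E * (Phi (p * w) ^+ N * arcsine_pdf w)%:E)).
  by apply: eq_integral => w _; rewrite -EFinM; congr (_%:E); ring.
rewrite ge0_integralZl//; last 3 first.
- apply/measurable_EFinP; apply: measurable_funM; first exact: measurable_PhiX.
  exact: measurable_arcsine_pdf.
- by move=> w _; rewrite lee_fin mulr_ge0 ?PhiX_ge0 ?arcsine_pdf_ge0.
- by rewrite lee_fin.
rewrite -arcsine_meanE -EFinM /e.
case: ifPn => [|/negP]; rewrite inE/= in_itv/=.
  move=> /andP[p0 pr]; rewrite max_l// ler_pXn2r ?nnegrE// pr mulr1.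
  by rewrite !mulrA.
move=> /negP; rewrite negb_and -!ltNge => /orP[p0|rp].
  by rewrite max_r ?(ltW p0)// !mul0r.
rewrite ler_pXn2r ?nnegrE//; last by rewrite (le_trans r0)// ltW.
by rewrite leNgt rp mulr0 !mul0r.
Qed.

End Disk.

Section Chord.
Context {R : realType}.
Local Notation mu := (@lebesgue_measure R).
Local Notation phi := (@normal_pdf R 0 1).
Local Notation gam := (@normal_prob R 0 1).
Local Notation co w := (Num.sqrt (1 - w ^+ 2)).
Variable N : nat.
Local Open Scope ereal_scope.

Lemma normal_prob_itv (a b : R) : (a <= b)%R -> gam `[a, b]%classic = (Phi b - Phi a)%:E.
Proof.
rewrite le_eqVlt => /predU1P[->|ab].
  by rewrite set_itv1 subrr /normal_prob integral_set1.
rewrite /normal_prob (@continuous_FTC2 R phi (@Phi R) a b ab); first by rewrite EFinB.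
- by apply: continuous_subspaceT; exact: continuous_std_normal_pdf.
- by apply: derivable_LRcontinuous => x; have [] := Phi_derive x.
- by move=> x _; have [] := Phi_derive x.
Qed.

(** The disk meets the line at height r w in a chord of half-length
    r sqrt (1 - w^2), which is 0 when the line misses the disk. *)
Lemma chord_mass (r w : R) : (0 < r)%R ->
  \int[mu]_x (((x ^+ 2 + (r * w) ^+ 2 <= r ^+ 2)%R%:R * phi x)%:E) =
  (Phi (r * co w) - Phi (- (r * co w)))%:E.
Proof.
move=> r0.
have [w1|w1] := leP 0%R (1 - w ^+ 2)%R; last first.
  rewrite ler0_sqrtr ?ltW// mulr0 oppr0 subrr; apply: integral0_eq => x _.
  case: leP => [xr|_]; last by rewrite mul0r.
  have r2 : (0 < r ^+ 2)%R by rewrite exprn_gt0.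
  have : (x ^+ 2 <= r ^+ 2 * (1 - w ^+ 2))%R by rewrite mulrBr mulr1 -exprMn lerBrDr.
  by rewrite leNgt (lt_le_trans _ (sqr_ge0 x))// pmulr_rlt0.
have c0 : (0 <= r * co w)%R by rewrite mulr_ge0 ?sqrtr_ge0// ltW.
rewrite -normal_prob_itv; last by rewrite (le_trans _ c0)// oppr_le0.
rewrite /normal_prob [RHS]integral_mkcond; apply: eq_integral => x _; rewrite patchE.
have -> : (x ^+ 2 + (r * w) ^+ 2 <= r ^+ 2)%R = (- (r * co w) <= x <= r * co w)%R.
  rewrite -ler_norml -[RHS](ler_pXn2r (n := 2)) ?nnegrE// real_normK ?num_real//.
  by rewrite (exprMn _ r (co w)) sqr_sqrtr// mulrBr mulr1 -exprMn lerBrDr.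
case: ifPn => [|/negP]; rewrite inE/= in_itv/=; first by move=> ->; rewrite mul1r.
by move=> /negP/negbTE ->; rewrite mul0r.
Qed.

Lemma chord_mass_ge0 (r w : R) : (0 <= r)%R ->
  (0 <= Phi (r * co w) - Phi (- (r * co w)))%R.
Proof.
move=> r0; rewrite -lee_fin -normal_prob_itv//.
by rewrite (@le_trans _ _ 0%R)// ?oppr_le0 mulr_ge0 ?sqrtr_ge0.
Qed.

(** Slices of the disk at height r w. *)
Lemma disk_mass_chord (r : R) : (0 <= r)%R -> disk_mass N r =
  \int[mu]_w (r * max_pdf N (r * w) * (Phi (r * co w) - Phi (- (r * co w))))%:E.
Proof.
rewrite le_eqVlt => /predU1P[<-|r0].
  rewrite disk_mass_polar// set_itv1 integral_set1.
  by rewrite integral0_eq// => w _; rewrite !mul0r.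
have mf : measurable_fun setT (fun z : R * R =>
    ((z.1 ^+ 2 + z.2 ^+ 2 <= r ^+ 2)%R%:R * (phi z.1 * max_pdf N z.2))%:E).
  apply/measurable_EFinP; apply: measurable_funM; first exact: measurable_sqr_le.
  apply: measurable_funM; first exact: (measurableT_comp measurable_phi).
  exact: (measurableT_comp (measurable_max_pdf N)).
have f0 (z : R * R) : 0 <= ((z.1 ^+ 2 + z.2 ^+ 2 <= r ^+ 2)%R%:R * (phi z.1 * max_pdf N z.2))%:E.
  by rewrite lee_fin mulr_ge0// mulr_ge0 ?normal_pdf_ge0 ?max_pdf_ge0.
rewrite /disk_mass (tonelliR mf f0) /=.
rewrite (@integral_affine_gt0 _ r 0)//; last 2 first.
- exact: (measurable_intl mf f0).
- by move=> y; apply: integral_ge0 => x _; exact: (f0 (x, y)).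
rewrite -ge0_integralZl//; last 3 first.
- apply: (measurableT_comp (measurable_intl mf f0)).
  by apply: measurable_funD => //; exact: measurable_funM.
- by move=> y _; apply: integral_ge0 => x _; exact: (f0 (x, (r * y + 0)%R)).
- by rewrite lee_fin ltW.
apply: eq_integral => w _; rewrite addr0.
transitivity (r%:E * \int[mu]_x
    ((((x ^+ 2 + (r * w) ^+ 2 <= r ^+ 2)%R%:R * phi x)%:E) * (max_pdf N (r * w))%:E)).
  by congr (_ * _); apply: eq_integral => x _; rewrite -EFinM mulrA.
rewrite ge0_integralZr//; last 3 first.
- apply/measurable_EFinP; apply: measurable_funM; last exact: measurable_phi.
  by apply: measurable_leR; apply: measurable_funD => //; exact: measurable_funX.
- by move=> x _; rewrite lee_fin mulr_ge0 ?normal_pdf_ge0.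
- by rewrite lee_fin max_pdf_ge0.
rewrite (chord_mass w r0) -!EFinM; congr (_%:E); ring.
Qed.

(** The two points (r + p c, p w) and (p + r c, r w) have the same norm. *)
Lemma pdf_swap (r p w c : R) : (c ^+ 2 = 1 - w ^+ 2)%R ->
  (phi (r + p * c) * phi (p * w) = phi (p + r * c) * phi (r * w))%R.
Proof.
move=> c2; rewrite (std_normal_pdfM (r + p * c) (p * w)) (std_normal_pdfM (p + r * c) (r * w)).
suff -> : ((r + p * c) ^+ 2 + (p * w) ^+ 2 = (p + r * c) ^+ 2 + (r * w) ^+ 2)%R by [].
have w2 : (w ^+ 2 = 1 - c ^+ 2)%R by rewrite c2 opprB addrC subrK.
by rewrite [in LHS]exprMn [in RHS](exprMn _ r) w2; ring.
Qed.

(** Polar coordinates centred at the point at distance r from the origin.  The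
    offset r w of the line depends only on the direction, and [pdf_swap] leaves
    the radial integral [gaussian_first_moment]. *)
Lemma hull_integral (r : R) : (0 <= r)%R ->
  N.+1%:R%:E * \int[mu]_x \int[mu]_y
    (phi (r + x) * phi y * Phi (r * y / Num.sqrt (x ^+ 2 + y ^+ 2)) ^+ N)%:E =
  (N.+1%:R * expR (- (r ^+ 2 / 2)) * arcsine_mean N r)%:E + disk_mass N r.
Proof.
move=> r0.
pose f (z : R * R) := (phi (r + z.1) * phi z.2 *
  Phi (r * z.2 / Num.sqrt (z.1 ^+ 2 + z.2 ^+ 2)) ^+ N)%:E.
have mf : measurable_fun setT f.
  apply/measurable_EFinP; apply: measurable_funM.
    apply: measurable_funM; apply: (measurableT_comp measurable_phi) => //.
    exact: measurable_funD.
  apply: measurable_funX; apply: (measurableT_comp measurable_Phi).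
  apply: measurable_funM; first exact: measurable_funM.
  apply: (measurableT_comp measurable_invr); apply: (measurableT_comp measurable_sqrt).
  by apply: measurable_funD; apply: measurable_funX.
have f0 z : 0 <= f z.
  rewrite lee_fin; apply: mulr_ge0; last exact: PhiX_ge0.
  by rewrite mulr_ge0 ?normal_pdf_ge0.
pose rad (w : R) : \bar R := ((phi (r * w) * Phi (r * w) ^+ N) *
   (2 * phi (r * co w) + r * co w * (Phi (r * co w) - Phi (- (r * co w)))))%:E.
rewrite -[X in _ * X]/(\int[mu]_x \int[mu]_y f (x, y)).
rewrite (@polar_eq _ f rad)//; last first.
  move=> w w1; rewrite /rad mulrC EFinM -first_moment_max0 -ge0_integralZr//; last 3 first.
  - apply/measurable_EFinP; apply: measurable_funM; first exact: measurable_max0.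
    by apply: measurable_funD; exact: measurable_phiD.
  - by move=> p _; rewrite lee_fin mulr_ge0 ?addr_ge0 ?normal_pdf_ge0// le_max lexx orbT.
  - by rewrite lee_fin; apply: mulr_ge0; [exact: normal_pdf_ge0|exact: PhiX_ge0].
  apply: eq_integral => p _; rewrite /f /= -EFinD -!EFinM; congr (_%:E).
  have [p0|p0] := leP p 0%R; first by rewrite !mul0r.
  have E : (Num.sqrt ((p * co w) ^+ 2 + (p * w) ^+ 2) = p)%R.
    have -> : ((p * co w) ^+ 2 + (p * w) ^+ 2 = p ^+ 2)%R.
      by rewrite !exprMn co_sqr//; ring.
    by rewrite sqrtr_sqr gtr0_norm.
  rewrite sqrrN E.
  have -> : (r * (p * w) / p = r * w)%R by rewrite mulrCA mulrAC divff ?mul1r// gt_eqF.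
  have E1 := @pdf_swap r p w _ (co_sqr w1).
  have E2 : (phi (r - p * co w) * phi (p * w) = phi (p - r * co w) * phi (r * w))%R.
    have cN : ((- co w) ^+ 2 = 1 - w ^+ 2)%R by rewrite sqrrN co_sqr.
    by have := @pdf_swap r p w _ cN; rewrite !mulrN.
  rewrite E1 E2; ring.
rewrite disk_mass_chord// EFinM arcsine_meanE.
have mc : measurable_fun [set: R] (fun w => r * co w)%R.
  by apply: measurable_funM => //; exact: measurable_co.
have mD : measurable_fun [set: R] (fun w => Phi (r * co w) - Phi (- (r * co w)))%R.
  apply: measurable_funB; apply: (measurableT_comp measurable_Phi) => //.
  exact: measurableT_comp.
have mrw : measurable_fun [set: R] (fun w => r * w)%R by exact: measurable_funM.
have mPhi := @measurable_PhiX R N r.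
have D0 w := chord_mass_ge0 w r0.
rewrite -ge0_integralZl//; last 2 first.
- apply: emeasurable_funM.
    by apply/measurable_EFinP; apply: measurable_funM => //; exact: measurable_arcsine_pdf.
  apply/measurable_EFinP; apply: measurable_funM.
    by apply: measurable_funM => //; exact: (measurableT_comp measurable_phi).
  apply: measurable_funD; last exact: measurable_funM.
  by apply: measurable_funM => //; exact: (measurableT_comp measurable_phi).
- move=> w _; rewrite mule_ge0// lee_fin; first by rewrite mulr_ge0 ?pi_ge0 ?arcsine_pdf_ge0.
  rewrite mulr_ge0//; first by apply: mulr_ge0; [exact: normal_pdf_ge0|exact: PhiX_ge0].
  by rewrite addr_ge0// mulr_ge0 ?normal_pdf_ge0// mulr_ge0// sqrtr_ge0.
rewrite -ge0_integralZl//; last 2 first.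
- apply/measurable_EFinP; apply: measurable_funM => //; exact: measurable_arcsine_pdf.
- by move=> w _; rewrite lee_fin mulr_ge0 ?PhiX_ge0 ?arcsine_pdf_ge0.
rewrite -ge0_integralD//; last 4 first.
- by move=> w _; rewrite mule_ge0// lee_fin mulr_ge0 ?expR_ge0 ?PhiX_ge0 ?arcsine_pdf_ge0.
- apply: emeasurable_funM => //; apply/measurable_EFinP; apply: measurable_funM => //.
  exact: measurable_arcsine_pdf.
- move=> w _; rewrite lee_fin; apply: mulr_ge0; last exact: D0.
  by apply: mulr_ge0 => //; exact: max_pdf_ge0.
- apply/measurable_EFinP; apply: measurable_funM => //; apply: measurable_funM => //.
  exact: (measurableT_comp (measurable_max_pdf N)).
apply: eq_integral => w _; rewrite /rad -!EFinM -EFinD; congr (_%:E).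
have [w1|] := boolP (-1 < w < 1)%R; last first.
  rewrite -ltr_norml -leNgt => w1.
  have cw : (co w = 0)%R.
    rewrite ler0_sqrtr// subr_le0 -[leRHS]real_normK ?num_real//.
    by rewrite exprn_ege1.
  rewrite arcsine_pdfE cw invr0 !(mulr0, mul0r) add0r oppr0 subrr mulr0.
  by [].
have c0 := lt0r_neq0 (sqrt1B_gt0 w1).
(* The point (r c, r w) is on the circle of radius r. *)
have E : (expR (- (r ^+ 2 / 2)) = 2 * pi * (phi (r * co w) * phi (r * w)))%R.
  rewrite (std_normal_pdfM (r * co w) (r * w)) mulrA divff ?mul1r; last first.
    by rewrite mulf_neq0// gt_eqF ?pi_gt0.
  suff -> : ((r * co w) ^+ 2 + (r * w) ^+ 2 = r ^+ 2)%R by [].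
  by rewrite !exprMn co_sqr//; ring.
rewrite E pi_arcsine_pdfE arcsine_pdfE /max_pdf.
have pn : (pi : R) != 0%R by rewrite gt_eqF ?pi_gt0.
move: (Phi (r * co w) - Phi (- (r * co w)))%R (Phi (r * w) ^+ N)%R => D C.
move: (phi (r * w)) (phi (r * co w)) => A B.
move: (co w) c0 => c c0; move: (pi : R) pn => q pn.
by field; rewrite c0 pn.
Qed.
End Chord.

(** * The probability of missing a point *)

Section HullProbability.
Context d (T : measurableType d) (R : realType) (P : probability T R) (n : nat)
  (X : 'I_n -> {RV P >-> (R * R)%type}).
Hypothesis X_gauss : forall i, standard_gaussian2 (X i).
Hypothesis X_indep : mutually_independent X.
Hypothesis n_gt1 : (1 < n)%N.
Local Notation gam := (@normal_prob R 0 1).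
Local Notation gam2 := (gam \x gam)%E.
Variable x : R * R.

(** Seen from x, all the other sample points are strictly to the left of
    X i. *)
Definition clockwise_most (i : 'I_n) : set T :=
  [set t | forall j, j != i -> 0 < orient x (X i t) (X j t)].

Lemma measurable_orient d' (T' : measurableType d') (f g : T' -> R * R) :
  measurable_fun setT f -> measurable_fun setT g ->
  measurable_fun setT (fun t => orient x (f t) (g t)).
Proof.
move=> mf mg.
have [mf1 mf2] : measurable_fun setT (fun t => (f t).1) /\ measurable_fun setT (fun t => (f t).2).
  by split; [exact: (measurableT_comp measurable_fst)|exact: (measurableT_comp measurable_snd)].
have [mg1 mg2] : measurable_fun setT (fun t => (g t).1) /\ measurable_fun setT (fun t => (g t).2).
  by split; [exact: (measurableT_comp measurable_fst)|exact: (measurableT_comp measurable_snd)].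
by apply: measurable_funB; apply: measurable_funM; apply: measurable_funB.
Qed.

Lemma measurable_gt0 d' (T' : measurableType d') (f : T' -> R) :
  measurable_fun setT f -> measurable [set t | 0 < f t].
Proof.
move=> mf; rewrite (_ : [set t | _] = f @^-1` `]0, +oo[).
  by rewrite -[X in measurable X]setTI; exact: mf.
by apply/seteqP; split => t /=; rewrite in_itv/= andbT.
Qed.

Lemma measurable_eq0 d' (T' : measurableType d') (f : T' -> R) :
  measurable_fun setT f -> measurable [set t | f t = 0].
Proof.
move=> mf; rewrite (_ : [set t | _] = f @^-1` [set 0])//.
by rewrite -[X in measurable X]setTI; exact: mf.
Qed.

Lemma measurable_finforall d' (T' : measurableType d') (I : finType) (Q : pred I)
    (F : I -> set T') : (forall i, Q i -> measurable (F i)) ->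
  measurable [set t | forall i, Q i -> F i t].
Proof.
move=> mF; rewrite (_ : [set t | _] = \bigcap_(i in [set i | Q i]) F i)//.
by apply: fin_bigcap_measurable => //; exact: finite_finset.
Qed.

Lemma measurable_clockwise_most i : measurable (clockwise_most i).
Proof.
by apply: measurable_finforall => j _; apply: measurable_gt0; exact: measurable_orient.
Qed.

Lemma law_gauss2 (i : 'I_n) (A : set (R * R)) : measurable A -> P (X i @^-1` A) = gam2 A.
Proof. by move=> mA; rewrite -(X_gauss i mA). Qed.

Lemma integral_law_gauss2 (i : 'I_n) (f : R * R -> \bar R) :
  measurable_fun setT f -> (forall z, 0 <= f z)%E ->
  (\int[distribution P (X i)]_y f y = \int[gam2]_y f y)%E.
Proof.
move=> mf f0; rewrite ge0_integral_distribution//.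
pose V := (measurableTypeR R * measurableTypeR R)%type.
have mX : measurable_fun setT (X i : T -> V) by have h : measurable_fun setT (X i) by []; exact: h.
transitivity (\int[pushforward P (X i : T -> V)]_y f y)%E.
  by rewrite ge0_integral_pushforward.
by apply: eq_measure_integral => A mA _; exact: law_gauss2.
Qed.

(** For a fixed value y of X i other than x, the point X j would lie on the
    line from x to y. *)
Lemma aligned_null i j : i != j -> P [set t | orient x (X i t) (X j t) = 0] = 0%E.
Proof.
move=> ij.
have iJ : i \notin [set j]%SET by rewrite inE.
have mj := @measurable_sigma_of_RV _ _ _ _ _ _ _ X [set j]%SET j (set11 _).
pose D := [set z : (R * R) * sigma_of X [set j]%SET | orient x z.1 (X j z.2) = 0].
have mD : measurable D.
  by apply: measurable_eq0; apply: measurable_orient => //; exact: (measurableT_comp mj).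
have mS : measurable_fun setT (fun y => P [set t | D (y, t)]) by exact: measurable_section.
rewrite (indep_disintegration X_indep iJ mD) integral_law_gauss2//.
pose V := (measurableTypeR R * measurableTypeR R)%type.
rewrite (@ge0_negligible_integral _ V R gam2 setT [set x])//.
- apply: integral0_eq => y [_ /= /eqP yx].
  rewrite -[RHS](gauss2_line yx) /D /= -(law_gauss2 j)//.
  by apply: measurable_eq0; exact: measurable_orient.
- exact: measurable_set1_pair.
- exact: gauss2_set1.
Qed.

(** Given X i = y, the other points are independent and each lies to the left
    of the line from x to y with probability [Phi (ray_offset x y)]. *)
Lemma probability_clockwise_most i :
  P (clockwise_most i) = (\int[gam2]_y (Phi (ray_offset x y) ^+ n.-1)%:E)%E.
Proof.
pose J : {set 'I_n} := [set~ i]%SET.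
have iJ : i \notin J by rewrite !inE eqxx.
pose D := [set z : (R * R) * sigma_of X J | forall j, j != i -> 0 < orient x z.1 (X j z.2)].
have mD : measurable D.
  apply: measurable_finforall => j ji; apply: measurable_gt0; apply: measurable_orient => //.
  have mj : measurable_fun setT (X j : sigma_of X J -> _).
    by apply: measurable_sigma_of_RV; rewrite !inE.
  exact: (measurableT_comp mj).
rewrite -[LHS]/(P [set t | D (X i t, t)]).
have mS : measurable_fun setT (fun y => P [set t | D (y, t)]) by exact: measurable_section.
rewrite (indep_disintegration X_indep iJ mD) integral_law_gauss2//.
pose V := (measurableTypeR R * measurableTypeR R)%type.
have mPhi : measurable_fun setT (fun y : V => (Phi (ray_offset x y) ^+ n.-1)%:E).
  exact: measurable_ray_offset.
rewrite (@ge0_negligible_integral _ V R gam2 setT [set x])//; last 2 first.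
- exact: measurable_set1_pair.
- exact: gauss2_set1.
rewrite [RHS](@ge0_negligible_integral _ V R gam2 setT [set x])//; last 3 first.
- exact: measurable_set1_pair.
- by move=> y _; rewrite lee_fin exprn_ge0// Phi_ge0.
- exact: gauss2_set1.
apply: eq_integral => y; rewrite inE => -[_ /= /eqP yx].
have mH : measurable [set z | 0 < orient x y z].
  by apply: measurable_gt0; exact: measurable_orient.
transitivity (P (\bigcap_(j in [set j | j \in J]) X j @^-1` [set z | 0 < orient x y z])).
  congr (P _); apply/seteqP; split => t /=.
    by move=> Dt j; rewrite /= !inE => ji; exact: Dt.
  by move=> h j ji; apply: (h j); rewrite /= !inE.
rewrite (X_indep (A := fun=> [set z | 0 < orient x y z]))//.
under eq_bigr do rewrite law_gauss2// (gauss2_left_side yx).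
by rewrite prodEFin prodr_const cardsC1 card_ord.
Qed.

Lemma in_bigsetU (I : finType) (Q : pred I) (F : I -> set T) t :
  (\big[setU/set0]_(i | Q i) F i) t <-> exists2 i, Q i & F i t.
Proof.
split; last by case=> i Qi Fit; rewrite (bigD1 i)//; left.
by apply: (@big_ind _ (fun A : set T => A t -> exists2 i, Q i & F i t));
  [|move=> A B hA hB [/hA|/hB]|move=> i Qi Fit; exists i].
Qed.

Lemma sume_const_ge0 (m : nat) (c : \bar R) : (0 <= c)%E ->
  (\sum_(i < m) c = m%:R%:E * c)%E.
Proof.
move=> c0; elim: m => [|m IH]; first by rewrite big_ord0 mul0e.
by rewrite big_ord_recr/= IH -natr1 EFinD ge0_muleDl// mul1e.
Qed.

Lemma trivIset_clockwise_most : trivIset setT clockwise_most.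
Proof.
apply/trivIsetP => i j _ _ ij; apply/seteqP; split => t //= [ti tj].
have ji : j != i by rewrite eq_sym.
have := ti j ji; have := tj i ij; rewrite orientC oppr_gt0 => /lt_trans /[apply].
by rewrite ltxx.
Qed.

(** The event coincides, up to alignments of x with two sample points, with
    the disjoint union of the n events [clockwise_most]. *)
Lemma probability_notin_hull :
  P [set t | ~ convex_hull [set (X i t : R^o * R^o) | i in [set: 'I_n]] (x : R^o * R^o)] =
  (n%:R%:E * \int[gam2]_y (Phi (ray_offset x y) ^+ n.-1)%:E)%E.
Proof.
pose H := [set t | exists i : 'I_n, forall j, cw_of x (X i t) (X j t)].
have -> : [set t | ~ convex_hull [set (X i t : R^o * R^o) | i in [set: 'I_n]]
    (x : R^o * R^o)] = H.
  apply/seteqP; split => t /=; rewrite (@notin_convex_hullP _ _ (fun i => X i t)) // card_ord.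
    exact: ltnW.
  exact: ltnW.
pose L := \big[setU/set0]_(i < n) clockwise_most i.
have LE t : L t <-> exists i, clockwise_most i t.
  by rewrite /L in_bigsetU; split => [[i _ ti]|[i ti]]; exists i.
have mL : measurable L by apply: bigsetU_measurable => i _; exact: measurable_clockwise_most.
have PL : P L = (n%:R%:E * \int[gam2]_y (Phi (ray_offset x y) ^+ n.-1)%:E)%E.
  rewrite /L measure_bigsetU_ord//; last 2 first.
  - by move=> i; exact: measurable_clockwise_most.
  - exact: trivIset_clockwise_most.
  transitivity (\sum_(i < n) \int[gam2]_y (Phi (ray_offset x y) ^+ n.-1)%:E)%E.
    by apply: eq_bigr => i _; exact: probability_clockwise_most.
  by apply: sume_const_ge0; apply: integral_ge0 => y _; rewrite lee_fin exprn_ge0// Phi_ge0.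
pose al (ij : 'I_n * 'I_n) := [set t | orient x (X ij.1 t) (X ij.2 t) = 0].
have mal ij : measurable (al ij) by apply: measurable_eq0; exact: measurable_orient.
pose N := \big[setU/set0]_(ij : 'I_n * 'I_n | ij.1 != ij.2) al ij.
have mN : measurable N by apply: bigsetU_measurable => ij _.
have PN : P N = 0%E.
  suff [] : measurable N /\ P N = 0%E by [].
  apply: (@big_ind _ (fun A : set T => measurable A /\ P A = 0%E)) => //.
    move=> A B [mA A0] [mB B0]; split; first exact: measurableU.
    have AB : (P A + P B = 0)%E by rewrite A0 B0 adde0.
    by apply/eqP; rewrite -measure_le0 -[leRHS]AB; exact: measureU2.
  by move=> ij neq; split; [exact: mal|exact: aligned_null].
have mH : measurable H.
  rewrite (_ : H = \bigcup_(i in [set: 'I_n]) [set t | forall j, true -> cw_of x (X i t) (X j t)]).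
    apply: fin_bigcup_measurable => // i _; apply: measurable_finforall => j _.
    have mo := @measurable_orient _ _ (X i) (X j).
    rewrite -[X in measurable X]/([set t | 0 < orient x (X i t) (X j t)] `|`
       ([set t | orient x (X i t) (X j t) = 0] `&`
        [set t | 0 < ((X i t).1 - x.1) * ((X j t).1 - x.1) +
                         ((X i t).2 - x.2) * ((X j t).2 - x.2)])).
    apply: measurableU; first by apply: measurable_gt0; exact: mo.
    apply: measurableI; first by apply: measurable_eq0; exact: mo.
    have m1 k : measurable_fun setT (fun t => (X k t).1 - x.1).
      by apply: measurable_funB => //; exact: (measurableT_comp measurable_fst).
    have m2 k : measurable_fun setT (fun t => (X k t).2 - x.2).
      by apply: measurable_funB => //; exact: (measurableT_comp measurable_snd).
    by apply: measurable_gt0; apply: measurable_funD; exact: measurable_funM.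
  by apply/seteqP; split => t [i]; [move=> ti; exists i|move=> _ ti; exists i => j; exact: ti].
have LH : L `<=` H.
  move=> t /LE[i ti]; exists i => j; have [->|ji] := eqVneq j i; last by left; exact: ti.
  (* A second sample point: its strict position to the left of X i excludes
     X i = x. *)
  pose k : 'I_n := if i == Ordinal (ltnW n_gt1) then Ordinal n_gt1 else Ordinal (ltnW n_gt1).
  have ki : k != i.
    by rewrite /k eq_sym; case: ifPn => // /eqP ->.
  have := ti k ki; have o0 : orient x (X i t) (X i t) = 0 by rewrite /orient; ring.
  move=> ok; right; split => //; rewrite -!expr2 lt_neqAle addr_ge0 ?sqr_ge0// andbT eq_sym.
  apply: contraL ok; rewrite paddr_eq0 ?sqr_ge0// !sqrf_eq0 => /andP[/eqP e1 /eqP e2].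
  by rewrite /orient e1 e2 !mul0r subrr ltxx.
have HLN : H `<=` L `|` N.
  move=> t [i ti]; have [Ht|] := pselect (clockwise_most i t); first by left; apply/LE; exists i.
  move=> /existsNP[j /not_implyP[ji nij]]; right; apply/in_bigsetU.
  exists (i, j) => /=; first by rewrite eq_sym.
  by case: (ti j) => // -[].
rewrite -PL; apply/eqP; rewrite eq_le; apply/andP; split; last first.
  by apply: le_measure; rewrite ?inE.
rewrite -[leRHS]adde0 -PN (le_trans _ (measureU2 _ mL mN))//.
by apply: le_measure; rewrite ?inE//; exact: measurableU.
Qed.

End HullProbability.

Section HullFormula.
Context {R : realType}.
Local Notation mu := (@lebesgue_measure R).
Local Notation phi := (@normal_pdf R 0 1).
Local Notation gam := (@normal_prob R 0 1).
Local Notation gam2 := (gam \x gam)%E.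
Local Open Scope ereal_scope.

Lemma ray_offset_rotation (a b : R) (x y : R * R) : (a ^+ 2 + b ^+ 2 = 1)%R ->
  ray_offset (a * x.1 - b * x.2, b * x.1 + a * x.2)%R (a * y.1 - b * y.2, b * y.1 + a * y.2)%R =
  ray_offset x y.
Proof.
move=> ab; rewrite /ray_offset /=; congr (_ / Num.sqrt _)%R.
  transitivity ((a ^+ 2 + b ^+ 2) * (x.1 * y.2 - x.2 * y.1))%R; first by ring.
  by rewrite ab mul1r.
transitivity ((a ^+ 2 + b ^+ 2) * ((y.1 - x.1) ^+ 2 + (y.2 - x.2) ^+ 2))%R; first by ring.
by rewrite ab mul1r.
Qed.

Lemma hull_mass_radial (x : R * R) (N : nat) :
  \int[gam2]_y (Phi (ray_offset x y) ^+ N)%:E =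
  \int[gam2]_y (Phi (ray_offset (euclidean_norm x, 0%R) y) ^+ N)%:E.
Proof.
have [a [b [ab xE]]] : exists a b : R, (a ^+ 2 + b ^+ 2 = 1)%R /\
    x = (a * euclidean_norm x - b * 0, b * euclidean_norm x + a * 0)%R.
  have s0 : (0 <= x.1 ^+ 2 + x.2 ^+ 2)%R by rewrite addr_ge0 ?sqr_ge0.
  have r2 : (euclidean_norm x ^+ 2 = x.1 ^+ 2 + x.2 ^+ 2)%R by rewrite sqr_sqrtr.
  have [r0|rn] := eqVneq (euclidean_norm x) 0%R.
    exists 1%R, 0%R; rewrite expr1n expr0n addr0 r0; split => //.
    move: r2; rewrite r0 expr0n => /esym/eqP; rewrite paddr_eq0 ?sqr_ge0// !sqrf_eq0.
    move=> /andP[/eqP x1 /eqP x2]; rewrite [LHS]surjective_pairing x1 x2.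
    by rewrite !(mulr0, mul0r) subr0 addr0.
  exists (x.1 / euclidean_norm x)%R, (x.2 / euclidean_norm x)%R; split.
    by rewrite !exprMn -mulrDl -r2 exprVn divff// expf_neq0.
  by rewrite !divfK// !mulr0 subr0 addr0 -surjective_pairing.
have mf : measurable_fun [set: R * R] (fun y => (Phi (ray_offset x y) ^+ N)%:E).
  exact: measurable_ray_offset.
rewrite -(gauss2_rotation ab mf); last by move=> z; rewrite lee_fin exprn_ge0// Phi_ge0.
apply: eq_integral => y _; rewrite {1}xE.
by rewrite (ray_offset_rotation (euclidean_norm x, 0%R) y ab).
Qed.

(** The translation by (r, 0) brings the observed point to the origin. *)
Lemma hull_mass_lebesgue (r : R) (N : nat) :
  \int[gam2]_y (Phi (ray_offset (r, 0%R) y) ^+ N)%:E =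
  \int[mu]_x \int[mu]_y
    (phi (r + x) * phi y * Phi (r * y / Num.sqrt (x ^+ 2 + y ^+ 2)) ^+ N)%:E.
Proof.
have mf : measurable_fun [set: R * R] (fun y => (Phi (ray_offset (r, 0%R) y) ^+ N)%:E).
  exact: measurable_ray_offset.
have f0 (y : R * R) : 0 <= (Phi (ray_offset (r, 0%R) y) ^+ N)%:E.
  by rewrite lee_fin exprn_ge0// Phi_ge0.
rewrite (integral_gauss2 mf f0).
pose f (z : R * R) := (Phi (ray_offset (r, 0%R) z) ^+ N)%:E * (phi z.1 * phi z.2)%:E.
have mg : measurable_fun setT f.
  apply: emeasurable_funM; first exact: mf.
  by apply/measurable_EFinP; apply: measurable_funM; exact: (measurableT_comp measurable_phi).
have g0 z : 0 <= f z by rewrite mule_ge0// lee_fin mulr_ge0 ?normal_pdf_ge0.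
rewrite (@integral_affine_gt0 _ 1 r)//; last 2 first.
- exact: (measurable_intr mg g0).
- by move=> x; apply: integral_ge0 => y _; exact: (g0 (x, y)).
rewrite mul1e; apply: eq_integral => x _; apply: eq_integral => y _.
rewrite -EFinM; congr (_%:E); rewrite mul1r mulrC (addrC x r); congr (_ * Phi _ ^+ N)%R.
by rewrite /ray_offset /= mul0r !subr0 (addrC r x) addrK.
Qed.

Lemma f_n2_formula d (T : measurableType d) (P : probability T R) (N : nat)
  (X : 'I_N.+1 -> {RV P >-> (R * R)%type}) (r : R) :
  (forall i, standard_gaussian2 (X i)) -> mutually_independent X -> (0 < N)%N ->
  (0 <= r)%R ->
  (f_n2 X r)%:E = (N.+1%:R * expR (- (r ^+ 2 / 2)) * arcsine_mean N r)%:E + disk_mass N r.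
Proof.
move=> Xg Xi N0 r0; rewrite -hull_integral// -hull_mass_lebesgue.
rewrite -(probability_notin_hull Xg Xi)// /f_n2 /prob_notin_hull fineK//.
rewrite (probability_notin_hull Xg Xi)// fin_numM// ge0_fin_numE; last first.
  by apply: integral_ge0 => y _; rewrite lee_fin exprn_ge0// Phi_ge0.
apply: (@le_lt_trans _ _ (\int[gam2]_(y in setT) (1 : R)%:E)).
  apply: ge0_le_integral => //.
  - by move=> y _; rewrite lee_fin exprn_ge0// Phi_ge0.
  - exact: measurable_ray_offset.
  - by move=> y _; rewrite lee_fin exprn_ile1// ?Phi_ge0 ?Phi_le1.
rewrite integral_cst// mul1e.
apply: (@le_lt_trans _ _ 1); last by rewrite ltry.
by rewrite le_eqVlt; apply/orP; left; apply/eqP; exact: probability_setT.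
Qed.

Lemma prob_notin_hull_radial d (T : measurableType d) (P : probability T R) (n : nat)
  (X : 'I_n -> {RV P >-> (R * R)%type}) (x : R * R) :
  (forall i, standard_gaussian2 (X i)) -> mutually_independent X -> (1 < n)%N ->
  prob_notin_hull X x = f_n2 X (euclidean_norm x).
Proof.
move=> Xg Xi n1; rewrite /f_n2 /prob_notin_hull.
by rewrite !(probability_notin_hull Xg Xi n1) hull_mass_radial.
Qed.
End HullFormula.

(** * The maximum of independent normal variables *)

Section Maximum.
Context d (T : measurableType d) (R : realType) (P : probability T R) (n : nat)
  (xi0 W : {RV P >-> R}) (xi : nat -> {RV P >-> R}).
Hypothesis xi_normal : forall i : 'I_n, standard_normal (xi i).
Hypothesis indep : mutually_independent (@joint_family d T R P n xi0 W xi).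
Local Notation mu := (@lebesgue_measure R).
Local Notation phi := (@normal_pdf R 0 1).
Local Notation gam := (@normal_prob R 0 1).
Local Open Scope ereal_scope.

Lemma running_max_le k t a : (0 < k)%N ->
  (running_max xi k t <= a)%R <-> forall i, (i < k)%N -> (xi i t <= a)%R.
Proof.
move=> k0; rewrite /running_max; split.
  by move=> /bigmax_leP[_ h] i ik; exact: (h (Ordinal ik)).
by move=> h; apply/bigmax_leP; split => [|i _]; exact: h.
Qed.

Definition maximands (k : nat) : {set option (option 'I_n)} :=
  [set Some (Some i) | i : 'I_n in [set i : 'I_n | (i < k)%N]%SET]%SET.

Lemma probability_max_le k a : (0 < k)%N -> (k <= n)%N ->
  P [set t | (running_max xi k t <= a)%R] = (Phi a ^+ k)%:E.
Proof.
move=> k0 kn.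
have -> : [set t | (running_max xi k t <= a)%R] =
    \bigcap_(j in [set j | j \in maximands k]) (joint_family xi0 W xi j @^-1` `]-oo, a]%classic).
  apply/seteqP; split => t /=.
    move=> /(running_max_le _ _ k0) h j /= /imsetP[i]; rewrite inE => ik ->.
    by rewrite /= in_itv/=; exact: h.
  move=> h; apply/(running_max_le _ _ k0) => i ik.
  have := h (Some (Some (Ordinal (leq_trans ik kn)))); rewrite /= in_itv/=; apply.
  by apply/imsetP; exists (Ordinal (leq_trans ik kn)) => //; rewrite inE.
rewrite (indep (A := fun=> `]-oo, a]%classic))// /maximands big_imset/=; last first.
  by move=> i j _ _ [].
transitivity (\prod_(i < n | (i < k)%N) (Phi a)%:E).
  apply: eq_big => [i|i _]; first by rewrite inE.
  by rewrite PhiE -(xi_normal i).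
by rewrite prodEFin -(big_ord_widen _ (fun=> Phi a)) // prodr_const card_ord.
Qed.

Lemma measurable_running_max k d' (T' : measurableType d') (f : T' -> T) :
  (0 < k)%N -> (forall i, (i < k)%N -> measurable_fun setT (fun t => xi i (f t))) ->
  measurable_fun setT (fun t => running_max xi k (f t)).
Proof.
move=> k0 mf; rewrite /running_max.
have mb (r : seq 'I_k) : measurable_fun setT
    (fun t => (\big[Num.max/xi 0%N (f t)]_(i <- r) xi i (f t))%R).
  elim: r => [|i r IH].
    by rewrite (_ : (fun t => _) = (fun t => xi 0%N (f t)))//;
      [exact: mf|apply/funext => t; rewrite big_nil].
  rewrite (_ : (fun t => _) = (fun t => Num.max (xi i (f t))
     (\big[Num.max/xi 0%N (f t)]_(i <- r) xi i (f t))%R)); last first.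
    by apply/funext => t; rewrite big_cons.
  by apply: measurable_maxr => //; exact: mf.
exact: mb.
Qed.

Lemma measurable_running_max_sigma k : (0 < k)%N -> (k <= n)%N ->
  measurable_fun [set: sigma_of (joint_family xi0 W xi) (maximands k)] (running_max xi k).
Proof.
move=> k0 kn.
apply: (@measurable_running_max k _ (sigma_of (joint_family xi0 W xi) (maximands k)) id k0) => i ik.
have im : Some (Some (Ordinal (leq_trans ik kn))) \in maximands k.
  by apply/imsetP; exists (Ordinal (leq_trans ik kn)) => //; rewrite inE.
have := @measurable_sigma_of_RV _ _ _ _ _ P _ (joint_family xi0 W xi) _ _ im.
by move=> /= H; exact: H.
Qed.

(** The maximum depends only on variables other than the one at j, hence is
    independent of it. *)
Lemma probability_max_pair k (j : option (option 'I_n)) (D : set (R * R)) :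
  (0 < k)%N -> (k <= n)%N -> j \notin maximands k -> measurable D ->
  P [set t | D (joint_family xi0 W xi j t, running_max xi k t)] =
  \int[distribution P (joint_family xi0 W xi j)]_y P [set t | D (y, running_max xi k t)].
Proof.
move=> k0 kn jk mD.
pose S := sigma_of (joint_family xi0 W xi) (maximands k).
pose D' := [set z : R * S | D (z.1, running_max xi k z.2)].
have mD' : measurable D'.
  rewrite -[X in measurable X]setTI.
  have : measurable_fun setT (fun z : R * S => (z.1, running_max xi k z.2)).
    apply: measurable_fun_pair => //.
    exact: (measurableT_comp (measurable_running_max_sigma k0 kn)).
  by move=> /(_ measurableT D mD).
exact: (indep_disintegration indep jk mD').
Qed.

Lemma measurable_max_section k (D : set (R * R)) :
  (0 < k)%N -> (k <= n)%N -> measurable D ->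
  measurable_fun setT (fun y => P [set t | D (y, running_max xi k t)]).
Proof.
move=> k0 kn mD.
pose S := sigma_of (joint_family xi0 W xi) (maximands k).
pose D' := [set z : R * S | D (z.1, running_max xi k z.2)].
have mD' : measurable D'.
  rewrite -[X in measurable X]setTI.
  have : measurable_fun setT (fun z : R * S => (z.1, running_max xi k z.2)).
    apply: measurable_fun_pair => //.
    exact: (measurableT_comp (measurable_running_max_sigma k0 kn)).
  by move=> /(_ measurableT D mD).
exact: (measurable_section mD').
Qed.

Lemma integral_density_RV (Y : {RV P >-> R}) (g : R -> R) (f : R -> \bar R) :
  measurable_fun setT g -> (forall y, (0 <= g y)%R) ->
  (forall A : set R, measurable A -> P (Y @^-1` A) = \int[mu]_(y in A) (g y)%:E) ->
  measurable_fun setT f -> (forall y, 0 <= f y) ->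
  \int[distribution P Y]_y f y = \int[mu]_y (f y * (g y)%:E).
Proof.
move=> mg g0 Yg mf f0; rewrite ge0_integral_distribution//.
have mY : measurable_fun setT (Y : T -> measurableTypeR R).
  by have h : measurable_fun setT Y by []; exact: h.
rewrite -(@ge0_integral_density _ (measurableTypeR R) R mu
  (pushforward P (Y : T -> measurableTypeR R)) g f mg g0 Yg mf f0).
by rewrite ge0_integral_pushforward.
Qed.

Lemma probability_max_le_arcsine k r : has_density P W (@arcsine_pdf R) ->
  (0 < k)%N -> (k <= n)%N ->
  P [set t | (running_max xi k t <= r * W t)%R] = (arcsine_mean k r)%:E.
Proof.
move=> [mW W0 dW] k0 kn.
pose D := [set z : R * R | (z.2 <= r * z.1)%R].
have mD : measurable D.
  rewrite (_ : D = [set z | (0 <= r * z.1 - z.2)%R]); last first.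
    by apply/seteqP; split => z; rewrite /D /= subr_ge0.
  rewrite (_ : [set z | _] = (fun z : R * R => r * z.1 - z.2)%R @^-1`
      `[0%R, +oo[%classic); last first.
    by apply/seteqP; split => z /=; rewrite in_itv/= andbT.
  rewrite -[X in measurable X]setTI.
  have : measurable_fun setT (fun z : R * R => r * z.1 - z.2)%R.
    by apply: measurable_funB => //; exact: measurable_funM.
  by apply.
have jk : Some None \notin maximands k by apply/imsetP => -[].
rewrite [LHS](probability_max_pair k0 kn jk mD) /=.
rewrite (integral_density_RV mW W0 dW)//; last exact: measurable_max_section.
rewrite arcsine_meanE; apply: eq_integral => w _.
by rewrite EFinM -(probability_max_le (r * w)%R k0 kn).
Qed.

Lemma is_derive_PhiX (N : nat) (y : R) :
  is_derive y 1%R (fun z => (Phi z ^+ N.+1)%R) (max_pdf N y).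
Proof.
have h := is_derive_Phi y; have hX := @is_deriveX _ _ (@Phi R) N.+1 y 1%R _ h.
rewrite (_ : (fun z => _) = (@Phi R) ^+ N.+1)%R; first exact: hX.
by apply/funext => z; rewrite fctE.
Qed.

(** On ]a, b] the two sides are Phi (b)^n - Phi (a)^n. *)
Lemma probability_max_density (N : nat) (A : set R) : n = N.+1 -> measurable A ->
  P (running_max xi n @^-1` A) = \int[mu]_(y in A) (max_pdf N y)%:E.
Proof.
move=> nN mA; have n0 : (0 < n)%N by rewrite nN.
have mM : measurable_fun setT (running_max xi n : T -> measurableTypeR R).
  by apply: (@measurable_running_max n _ T id).
have mMle (a : R) : measurable [set t | (running_max xi n t <= a)%R].
  rewrite -[X in measurable X]setTI (_ : [set t | _] = running_max xi n @^-1` `]-oo, a]%classic).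
    by apply: mM.
  by apply/seteqP; split => t /=; rewrite in_itv.
have PE (a b : R) : (a < b)%R ->
    P (running_max xi n @^-1` `]a, b]%classic) = (Phi b ^+ n - Phi a ^+ n)%:E.
  move=> ab.
  rewrite (_ : _ @^-1` _ = [set t | (running_max xi n t <= b)%R] `\`
     [set t | (running_max xi n t <= a)%R]).
    rewrite measureD//; last by rewrite -ge0_fin_numE// fin_num_measure.
    rewrite setIidr; last by move=> t /= /le_trans; apply; exact: ltW.
    by rewrite EFinB -(probability_max_le b n0 (leqnn n)) -(probability_max_le a n0 (leqnn n)).
  apply/seteqP; split => t /=; rewrite in_itv/=.
    by move=> /andP[at_ tb]; split => //; apply/negP; rewrite -ltNge.
  by move=> [-> /negP]; rewrite -ltNge => ->.
apply: (@density_unique R (pushforward P (running_max xi n : T -> measurableTypeR R))) => //.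
- exact: measurable_max_pdf.
- by move=> y; exact: max_pdf_ge0.
- by move=> a b ab; rewrite /= /pushforward PE// ltry.
- move=> a b ab; rewrite /= /pushforward PE// integral_itv_obnd_cbnd; last first.
    by apply/measurable_funTS/measurable_EFinP; exact: measurable_max_pdf.
  rewrite (@continuous_FTC2 R (max_pdf N) (fun z => Phi z ^+ N.+1)%R a b ab).
  + by rewrite nN EFinB.
  + apply: continuous_subspaceT => y; apply: cvgM; last exact: continuous_std_normal_pdf.
    apply: cvgM; first exact: cvg_cst.
    apply: (cvg_comp (@Phi R) (fun q : R => q ^+ N)%R); first exact: continuous_Phi.
    exact: exprn_continuous.
  + by apply: derivable_LRcontinuous => y; have := is_derive_PhiX N y => ?; exact: ex_derive.
  + by move=> y _; have := is_derive_PhiX N y => ?; rewrite derive1E derive_val.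
Qed.

Lemma probability_disk (N : nat) (r : R) : n = N.+1 -> standard_normal xi0 ->
  P [set t | (running_max xi n t ^+ 2 + xi0 t ^+ 2 <= r ^+ 2)%R] = disk_mass N r.
Proof.
move=> nN xi0n; have n0 : (0 < n)%N by rewrite nN.
pose D := [set z : R * R | (z.1 ^+ 2 + z.2 ^+ 2 <= r ^+ 2)%R].
have mD : measurable D.
  rewrite (_ : D = (fun z : R * R => z.1 ^+ 2 + z.2 ^+ 2)%R @^-1`
      `]-oo, (r ^+ 2)%R]%classic); last first.
    by apply/seteqP; split => z /=; rewrite in_itv.
  rewrite -[X in measurable X]setTI.
  have : measurable_fun setT (fun z : R * R => z.1 ^+ 2 + z.2 ^+ 2)%R.
    by apply: measurable_funD; apply: measurable_funX.
  by apply.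
have jk : None \notin maximands n by apply/imsetP => -[].
transitivity (P [set t | D (xi0 t, running_max xi n t)]).
  by congr (P _); apply/seteqP; split => t; rewrite /D /= addrC.
rewrite [LHS](probability_max_pair n0 (leqnn n) jk mD) /=.
have dxi0 (A : set R) : measurable A -> P (xi0 @^-1` A) = \int[mu]_(y in A) (phi y)%:E.
  by move=> mA; rewrite -[RHS]/(gam A) -(xi0n A mA).
rewrite (integral_density_RV measurable_phi (normal_pdf_ge0 0 1) dxi0)//; last first.
  exact: measurable_max_section.
apply: eq_integral => x _.
have mDx : measurable [set y | D (x, y)].
  by have := measurable_xsection x mD; rewrite /xsection; under eq_set do rewrite inE.
rewrite -[X in P X]/(running_max xi n @^-1` [set y | D (x, y)]) (probability_max_density nN mDx).
rewrite -ge0_integralZr//; last 3 first.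
- by apply/measurable_funTS/measurable_EFinP; exact: measurable_max_pdf.
- by move=> y _; rewrite lee_fin max_pdf_ge0.
- by rewrite lee_fin normal_pdf_ge0.
rewrite integral_mkcond; apply: eq_integral => y _; rewrite patchE -EFinM.
have -> : (y \in [set y | D (x, y)]) = (x ^+ 2 + y ^+ 2 <= r ^+ 2)%R.
  by apply/idP/idP; rewrite inE.
by case: ifP => _; rewrite ?mul0r// mul1r mulrC.
Qed.
End Maximum.

(** * The distribution of half the squared distance *)

Section Calculus.
Context {R : realType}.
Local Notation mu := (@lebesgue_measure R).

(** At 0 the difference quotient of F for positive increments is that of H,
    which is differentiable there. *)
Lemma derive_nneg_primitive (F H h : R -> R) (u : R) :
  (forall v, 0 <= v -> F v = H v - H 0) -> is_derive u 1 H (h u) -> 0 <= u ->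
  derivable_nneg F u /\ derive_nneg F u = h u.
Proof.
move=> FH dH u0; rewrite /derivable_nneg /derive_nneg.
case: ifPn => [/eqP uE|un].
  subst u.
  have c : h0^-1 * (F h0 - F 0) @[h0 --> 0^'+] --> h 0.
    case: dH => dH <-.
    have : t^-1 *: (H (t *: 1 + 0) - H 0) @[t --> 0^'] --> 'D_1 H 0 by exact: dH.
    move/cvg_dnbhs_at_right; apply: cvg_trans; apply: near_eq_cvg; near=> t.
    have t0 : 0 <= t by near: t; exact: nbhs_right_ge.
    by rewrite /GRing.scale /= mulr1 addr0 !FH// subrr subr0.
  by split; [apply/cvg_ex; exists (h 0)|apply/cvg_lim].
have up : 0 < u by rewrite lt0r un.
have HF : \forall v \near u, (H - cst (H 0)) v = F v.
  near=> v; rewrite FH//; near: v.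
  exact: (@cvgr_ge _ _ _ _ id u).
have dF : is_derive u 1 F (h u).
  by apply: near_eq_is_derive HF _; apply: is_derive_eq; rewrite subr0.
by split; [exact: ex_derive|rewrite derive1E derive_val].
Unshelve. all: by end_near. Qed.

Variable N : nat.

(** For negative v the square root is 0: the function extends continuously to
    the whole line, so that 0 is not an exceptional point for its primitive. *)
Definition radial_density (v : R) : R :=
  N.+1%:R * expR (- v) * arcsine_mean N (Num.sqrt (2 * v)).

Lemma continuous_radial_density : continuous radial_density.
Proof.
move=> v; apply: cvgM.
  apply: cvgM; first exact: cvg_cst.
  by apply: (cvg_comp (fun v => - v) expR); [exact: opp_continuous|exact: continuous_expR].
apply: (cvg_comp (fun v => Num.sqrt (2 * v))); last exact: continuous_arcsine_mean.
apply: (cvg_comp (fun v => 2 * v)); last exact: sqrt_continuous.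
by apply: cvgM; [exact: cvg_cst|exact: cvg_id].
Qed.

Lemma measurable_radial_density : measurable_fun [set: R] (radial_density : R -> R).
Proof. apply: continuous_measurable_fun; exact: continuous_radial_density. Qed.

Lemma radial_density_ge0 v : 0 <= radial_density v.
Proof. by rewrite /radial_density !mulr_ge0 ?expR_ge0 ?arcsine_mean_ge0. Qed.

(** The substitution v = p^2 / 2. *)
Lemma disk_mass_radial (u : R) : 0 <= u ->
  disk_mass N (Num.sqrt (2 * u)) = (\int[mu]_(v in `[0%R, u]) (radial_density v)%:E)%E.
Proof.
move=> u0; have r0 : 0 <= Num.sqrt (2 * u) by [].
rewrite disk_mass_polar//; set r := Num.sqrt _ in r0 *.
pose F (p : R) := p ^+ 2 / 2.
have dF (p : R) : is_derive p 1 F p.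
  by rewrite /F; apply: is_derive_eq; rewrite /GRing.scale/=; field.
have F'E : F^`()%classic = id by apply/funext => p; have := dF p => ?; rewrite derive1E derive_val.
have Fr : F r = u by rewrite /F sqr_sqrtr ?mulr_ge0//; field.
have F0 : F 0 = 0 by rewrite /F expr0n mul0r.
transitivity (\int[mu]_(v in `[F 0%R, F r]) (radial_density v)%:E)%E; last by rewrite F0 Fr.
rewrite integration_by_substitution_increasing//.
- apply: eq_integral => p; rewrite inE/= in_itv/= => /andP[p0 _]; congr (_%:E).
  rewrite F'E /radial_density /F fctE /=.
  have -> : 2 * (p ^+ 2 / 2) = p ^+ 2 by field.
  by rewrite sqrtr_sqr ger0_norm//; ring.
- move=> p q; rewrite !in_itv/= => /andP[p0 _] /andP[q0 _] pq.
  by rewrite /F ltr_pM2r ?invr_gt0// ltr_pXn2r ?nnegrE.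
- by rewrite F'E => p _; exact: cvg_id.
- by rewrite F'E; apply: cvgP; apply: cvg_at_right_filter; exact: cvg_id.
- by rewrite F'E; apply: cvgP; apply: cvg_at_left_filter; exact: cvg_id.
- by apply: derivable_LRcontinuous => p; have := dF p => ?; exact: ex_derive.
- by apply: continuous_subspaceT; exact: continuous_radial_density.
Qed.

(** The primitive starts at -1 so that 0 is an interior point. *)
Lemma is_derive_radial_density (u : R) : 0 <= u ->
  is_derive u 1 (fun v => \int[mu]_(t in `[-1, v]) radial_density t) (radial_density u).
Proof.
move=> u0.
have ir : mu.-integrable `[-1, u + 1] (EFin \o radial_density).
  apply: continuous_compact_integrable; first exact: segment_compact.
  by apply: continuous_subspaceT; exact: continuous_radial_density.
have [|||dH dE] := @continuous_FTC1_closed R radial_density (-1) u (u + 1) _ ir.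
- by rewrite ltrDl.
- by rewrite (lt_le_trans _ u0)// ltrN10.
- exact: continuous_radial_density.
by rewrite -dE derive1E; exact: derivableP.
Qed.

Lemma disk_mass_fin_num (u : R) : 0 <= u -> disk_mass N (Num.sqrt (2 * u)) \is a fin_num.
Proof.
move=> u0; rewrite disk_mass_radial//; apply: integrable_fin_num => //.
apply: continuous_compact_integrable; first exact: segment_compact.
by apply: continuous_subspaceT; exact: continuous_radial_density.
Qed.

Lemma disk_mass_primitive (u : R) : 0 <= u ->
  fine (disk_mass N (Num.sqrt (2 * u))) =
  (\int[mu]_(t in `[-1, u]) radial_density t)%R - (\int[mu]_(t in `[-1, 0]) radial_density t)%R.
Proof.
move=> u0; rewrite disk_mass_radial//.
have ir (a b : R) : mu.-integrable `[a, b] (EFin \o radial_density).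
  apply: continuous_compact_integrable; first exact: segment_compact.
  by apply: continuous_subspaceT; exact: continuous_radial_density.
rewrite Rintegral_itvB//; last by rewrite bnd_simp lerN10.
rewrite Rintegral_itv_obnd_cbnd//.
by apply: integrableS (ir 0 u) => //; apply: subset_itvr; rewrite bnd_simp.
Qed.
End Calculus.

Section HalfSquare.
Context d (T : measurableType d) (R : realType) (P : probability T R) (N : nat)
  (xi0 W : {RV P >-> R}) (xi : nat -> {RV P >-> R}).
Hypothesis xi0_normal : standard_normal xi0.
Hypothesis xi_normal : forall i : 'I_N.+1, standard_normal (xi i).
Hypothesis indep : mutually_independent (@joint_family d T R P N.+1 xi0 W xi).
Local Notation mu := (@lebesgue_measure R).
Local Notation M := (running_max xi N.+1).

Lemma probability_disk_le (u : R) : 0 <= u ->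
  P [set t | M t ^+ 2 + xi0 t ^+ 2 <= 2 * u] = disk_mass N (Num.sqrt (2 * u)).
Proof.
move=> u0; rewrite -(probability_disk xi_normal indep _ erefl xi0_normal).
by rewrite sqr_sqrtr// mulr_ge0.
Qed.

Lemma half_square_has_density :
  has_density P (fun t => 2^-1 * (M t ^+ 2 + xi0 t ^+ 2))
    (fun v => (0 <= v)%R%:R * radial_density N v).
Proof.
set Z := fun t => _; set g := fun v => _.
have mr : measurable_fun [set: R] (radial_density N : R -> R).
  exact: measurable_radial_density.
have mg : measurable_fun [set: R] (g : R -> R).
  apply: measurable_funM => //.
  rewrite (_ : (fun v => _) = fun v : R => ((- v <= 0)%R%:R : R)).
    by apply: measurable_leR; exact: oppr_measurable.
  by apply/funext => v; rewrite oppr_le0.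
have g0 v : 0 <= g v by rewrite mulr_ge0// radial_density_ge0.
split => //.
have mZ : measurable_fun setT (Z : T -> measurableTypeR R).
  have mM : measurable_fun setT M by apply: (@measurable_running_max _ _ _ _ xi N.+1 _ T id).
  apply: measurable_funM => //.
  by apply: measurable_funD; apply: measurable_funX.
have mle a : measurable (Z @^-1` `]-oo, a]%classic).
  by rewrite -[X in measurable X]setTI; apply: mZ.
apply: (@density_unique_ray R (pushforward P (Z : T -> measurableTypeR R))) => //.
  by move=> a; apply: (le_lt_trans (probability_le1 P (mle a))); rewrite ltry.
move=> a; rewrite /= /pushforward.
have [a0|a0] := ltP a 0.
  rewrite (_ : Z @^-1` _ = set0) ?measure0.
    apply/esym/integral0_eq => v; rewrite /= in_itv/= => va.
    by rewrite /g leNgt (le_lt_trans va)//= mul0r.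
  apply/seteqP; split => t //=; rewrite in_itv/= leNgt (lt_le_trans a0)//.
  by rewrite mulr_ge0 ?invr_ge0// addr_ge0 ?sqr_ge0.
rewrite (_ : Z @^-1` _ = [set t | M t ^+ 2 + xi0 t ^+ 2 <= 2 * a]); last first.
  by apply/seteqP; split => t /=; rewrite in_itv/= /Z ler_pdivrMl.
rewrite probability_disk_le// disk_mass_radial// [LHS]integral_mkcond [RHS]integral_mkcond.
apply: eq_integral => v _; rewrite !patchE /g.
case: ifPn => [|/negP]; rewrite inE/= in_itv/=.
  by move=> /andP[v0 va]; rewrite mem_set/= ?in_itv//= v0 mul1r.
move=> nv; case: ifPn => //; rewrite inE/= in_itv/= => va.
by case: leP nv => v0 nv; [case: nv; rewrite va|rewrite mul0r].
Qed.
End HalfSquare.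

Theorem theorem1p5 (R : realType) (n : nat) (hn : (3 <= n)%N)
    (d1 : measure_display) (T1 : measurableType d1) (P1 : probability T1 R)
    (X : 'I_n -> {RV P1 >-> (R * R)%type})
    (X_gauss : forall i : 'I_n, standard_gaussian2 (X i))
    (X_indep : mutually_independent X)
    (d2 : measure_display) (T2 : measurableType d2) (P2 : probability T2 R)
    (xi0 W : {RV P2 >-> R}) (xi : nat -> {RV P2 >-> R})
    (xi0_normal : standard_normal xi0)
    (xi_normal : forall i : 'I_n, standard_normal (xi i))
    (W_arcsine : has_density P2 W (@arcsine_pdf R))
    (xiW_indep : mutually_independent (@joint_family d2 T2 R P2 n xi0 W xi)) :
  let M := running_max xi in
  let F (u : R) :=
    fine (P2 [set t | M n t ^+ 2 + xi0 t ^+ 2 <= 2 * u]) in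
  [/\ forall x : R * R, prob_notin_hull X x = f_n2 X (euclidean_norm x),
      forall u : R, 0 <= u ->
        [/\ derivable_nneg F u,
            f_n2 X (Num.sqrt (2 * u)) = F u + derive_nneg F u
          & F u + derive_nneg F u =
            F u + n%:R * expR (- u) *
              fine (P2 [set t | M n.-1 t <= Num.sqrt (2 * u) * W t])]
    & let Z (t : T2) := 2^-1 * (M n t ^+ 2 + xi0 t ^+ 2) in
      exists g : R -> R, has_density P2 Z g /\
        forall u : R, 0 <= u ->
          f_n2 X (Num.sqrt (2 * u)) = fine (P2 [set t | Z t <= u]) + g u].
Proof.
case: n hn X X_gauss X_indep xi_normal xiW_indep => [//|N] N2 X X_gauss X_indep
  xi_normal xiW_indep M F.
have N0 : (0 < N)%N by rewrite -ltnS (ltn_trans _ N2).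
have FE u : 0 <= u -> F u = fine (disk_mass N (Num.sqrt (2 * u))).
  by move=> u0; rewrite /F (probability_disk_le xi0_normal xi_normal xiW_indep u0).
have F_prim u : 0 <= u -> derivable_nneg F u /\ derive_nneg F u = radial_density N u.
  move=> u0; apply: (derive_nneg_primitive (H := fun v =>
    (\int[lebesgue_measure]_(t in `[-1, v]) radial_density N t)%R)) => //.
    by move=> v v0; rewrite FE// disk_mass_primitive.
  exact: is_derive_radial_density.
have hullE u : 0 <= u -> f_n2 X (Num.sqrt (2 * u)) = F u + radial_density N u.
  move=> u0; have u2 : 0 <= 2 * u by rewrite mulr_ge0.
  have := f_n2_formula X_gauss X_indep N0 (sqrtr_ge0 (2 * u)).
  move/(congr1 fine) => /= ->.
  rewrite fineD//; last exact: disk_mass_fin_num.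
  rewrite addrC FE//; congr (_ + _); rewrite /= /radial_density sqr_sqrtr//.
  by congr (_ * expR (- _) * _); field.
split.
- by move=> x; apply: prob_notin_hull_radial => //; exact: leq_trans N2.
- move=> u u0; have [dF ->] := F_prim u u0; split => //; first exact: hullE.
  congr (_ + _); rewrite /radial_density /=; congr (_ * _).
  by rewrite (probability_max_le_arcsine xi_normal xiW_indep _ W_arcsine N0 (leqnSn N)).
- move=> Z; exists (fun v => (0 <= v)%R%:R * radial_density N v); split.
    exact: half_square_has_density xi0_normal xi_normal xiW_indep.
  move=> u u0; rewrite hullE// u0 mul1r; congr (_ + _); congr (fine (P2 _)).
  by apply/seteqP; split => t /=; rewrite /Z ler_pdivrMl.
Qed.
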